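(* Let $e\ge 10$ and let $1\le m<n\le e-2$ be integers with $(m,n)\ne(e-4,e-3)$. Let $\mathcal G_{S(e,m,n)}=G_{S(e,m,n)}\cup G'_{S(e,m,n)}$ be the set of polynomials defined explicitly in the context, and let $\mathcal G^h_{S(e,m,n)}=\{f^h\mid f\in\mathcal G_{S(e,m,n)}\}$ be the set of homogenizations of its elements with respect to the variable $y$. Then $\mathcal G^h_{S(e,m,n)}$ is a Gröbner basis of $I_{\overline{S(e,m,n)}}$ with respect to the graded reverse lexicographic order on $R(e,m,n)[y]$.
   Context: $\mathbb K$ is an algebraically closed field of characteristic zero. $R(e,m,n)=\mathbb K[\{x_0,\ldots,x_{e-1}\}\setminus\{x_m,x_n\}]$. $\overline{S(e,m,n)}\subseteq\mathbb N^2$ is the affine semigroup generated by $(e+i,\,e-1-i)$ for $i\in\{0,\ldots,e-1\}\setminus\{m,n\}$ together with $(0,2e-1)$. $I_{\overline{S(e,m,n)}}$ is the kernel of the $\mathbb K$-algebra homomorphism $R(e,m,n)[y]\to\mathbb K[t_1,t_2]$, $x_i\mapsto t_1^{e+i}t_2^{e-1-i}$, $y\mapsto t_2^{2e-1}$. The graded reverse lexicographic order is taken with $x_0>x_1>\cdots>x_{e-1}>y$ (so $y$ is the smallest variable). All variables have degree 1. Write $[a,b]$ for the set of integers $i$ with $a\le i\le b$ (empty if $a>b$); index ranges with lower bound exceeding upper bound are empty. **The set $G_{S(e,m,n)}$ for $m=1$.** $G_{S(e,1,n)}=J_n\cup K_n\cup L_{e,n}$, where $J_n$ is the set of all $2\times2$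 minors of $A_n$ and $K_n$ the set of $2\times 2$ minors of $B_n$ involving its first column. $A_n$ has columns $\begin{bmatrix} x_i \\ x_{i+1} \end{bmatrix}$ for $i\in[2,n-2]$, then for $i\in[n+1,e-2]$, then $\begin{bmatrix} x_{e-1} \\ x_0^2 \end{bmatrix}$. $B_2$ has columns $\begin{bmatrix} x_0 \\ x_3 \end{bmatrix}$, $\begin{bmatrix} x_i \\ x_{i+3} \end{bmatrix}$ for $i\in[3,e-4]$, $\begin{bmatrix} x_{e-3} \\ x_0^2 \end{bmatrix}$. For $n\ge3$, $B_n$ has columns $\begin{bmatrix} x_0 \\ x_2 \end{bmatrix}$, $\begin{bmatrix} x_i \\ x_{i+2} \end{bmatrix}$ for $i\in[2,n-3]$, $\begin{bmatrix} x_{n-1} \\ x_{n+1} \end{bmatrix}$, $\begin{bmatrix} x_i \\ x_{i+2} \end{bmatrix}$ for $i\in[n+1,e-3]$, and, if $n\ne e-2$, $\begin{bmatrix} x_{e-2} \\ x_0^2 \end{bmatrix}$. Further: - $L_{e,2}=\emptyset$. - $L_{e,3}=\{x_4x_{4+i}-x_2x_{6+i}\mid i\in[0,e-7]\}\cup\{x_0^2x_2-x_4x_{e-2}\}$. - $L_{e,4}=\{x_5x_{5+i}-x_3x_{7+i}\mid i\in[0,e-8]\}\cup\{x_3^2-x_0x_6,\ x_0^2x_3-x_5x_{e-2},\ x_0x_2^2-x_5x_{e-1},\ x_2^3-x_7x_{e-1}\}$. - For $5\le n\le e-4$: $L_{e,n}=\{x_{n+1}x_{n+1+i}-x_{n-1}x_{n+3+i}\mid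 i\in[0,e-n-4]\}\cup\{x_{n-1}x_{n-1-i}-x_{n+1}x_{n-3-i}\mid i\in[0,n-5]\}\cup\{x_{n-1}x_3-x_{n+2}x_0,\ x_0^2x_{n-1}-x_{n+1}x_{e-2},\ x_0x_2x_{n-2}-x_{n+1}x_{e-1}\}$. - $L_{e,e-3}=\{x_{e-4}x_{e-4-i}-x_{e-2}x_{e-6-i}\mid i\in[0,e-8]\}\cup\{x_{e-4}x_3-x_0x_{e-1},\ x_0^2x_{e-4}-x_{e-2}^2,\ x_0x_2x_{e-5}-x_{e-2}x_{e-1}\}$. - $L_{e,e-2}=\{x_{e-3}x_{e-3-i}-x_{e-1}x_{e-5-i}\mid i\in[0,e-7]\}\cup\{x_0^3-x_3x_{e-3},\ x_0x_2x_{e-4}-x_{e-1}^2\}$. **The set $G_{S(e,m,n)}$ for $m\ge2$.** $G_{S(e,m,n)}=J_{m,n}\cup K_{m,n}$, where $J_{m,n}$ is the set of all $2\times2$ minors of the matrix $A_{m,n}$ with columns $\begin{bmatrix} x_i \\ x_{i+1} \end{bmatrix}$ for $i\in[0,m-2]$, then for $i\in[m+1,n-2]$, then for $i\in[n+1,e-2]$, then $\begin{bmatrix} x_{e-1} \\ x_0^2 \end{bmatrix}$; and $K_{m,n}$ is as follows (in each item $m,n$ are the indices of $K_{m,n}$): 1. $K_{2,3}=\{x_{n+1}x_{n+1+j}-x_{n-2}x_{n+4+j}\mid j\in[0,e-n-5]\}\cup\{x_0^2x_{m-1}-x_{m+3}x_{e-4},\ x_0x_1x_{m-1}-x_{m+3}x_{e-3},\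 x_1^3-x_4x_{e-1}\}$. 2. $K_{2,4}=\{x_{m+1}x_{m+1+j}-x_{m-1}x_{m+3+j}\mid j\in[0,e-m-4]\setminus\{1\}\}\cup\{x_{n+1}x_{n+1+j}-x_{n-1}x_{n+3+j}\mid j\in[0,e-n-4]\}\cup\{x_0^2x_{m-1}-x_{m+1}x_{e-2},\ x_0x_1x_{m-1}-x_{m+1}x_{e-1},\ x_0x_1x_{n-1}-x_{n+2}x_{e-2},\ x_0^2x_{n-1}-x_{n+2}x_{e-3},\ x_1^3-x_6x_{e-3},\ x_1^2x_{n-1}-x_{n+2}x_{e-1}\}$. 3. $K_{2,5}=\{x_{m+1}^2-x_{m-2}x_{m+4}\}\cup\{x_{m+1}x_{m+1+j}-x_{m-1}x_{m+3+j}\mid j\in[1,e-m-4]\setminus\{2\}\}\cup\{x_{n+1}x_{n+1+j}-x_{n-1}x_{n+3+j}\mid j\in[0,e-n-4]\}\cup\{x_{n-1}^2-x_{n+2}x_{n-4}\}\cup\{x_0x_1x_{n-1}-x_{n+2}x_{e-2},\ x_0^2x_{n-1}-x_{n+2}x_{e-3},\ x_1^2x_{n-1}-x_{n+2}x_{e-1},\ x_0^2x_{m-1}-x_{m+2}x_{e-3},\ x_0x_1x_{m-1}-x_{m+2}x_{e-2},\ x_1^3-x_4x_{e-1}\}$. 4. For $6\le n\le e-4$: $K_{2,n}=\{x_{m+1}x_{n-2}-x_0x_{n+1}\}\cup\{x_{m+1}x_{m+1+j}-x_{m-1}x_{m+3+j}\mid j\in[0,e-m-4]\setminus\{n-m-1,n-m-3\}\}\cup\{x_{n+1}x_{n+1+j}-x_{n-1}x_{n+3+j}\mid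 j\in[0,e-n-4]\}\cup\{x_{n-1}x_{n-1-j}-x_{n+1}x_{n-3-j}\mid j\in[0,n-m-4]\}\cup\{x_{n-1}x_{m+2}-x_{n+2}x_{m-1}\}\cup\{x_0x_1x_{n-1}-x_{n+2}x_{e-2},\ x_0^2x_{n-1}-x_{n+2}x_{e-3},\ x_0^2x_{m-1}-x_{m+2}x_{e-3},\ x_0x_1x_{m-1}-x_{m+2}x_{e-2},\ x_1^3-x_4x_{e-1}\}$. 5. $K_{2,e-3}=\{x_{m+1}x_{n-2}-x_0x_{n+1}\}\cup\{x_{m+1}x_{m+1+j}-x_{m-1}x_{m+3+j}\mid j\in[0,e-m-5]\setminus\{n-m-3\}\}\cup\{x_{n-1}x_{n-1-j}-x_{n+1}x_{n-3-j}\mid j\in[0,n-m-4]\}\cup\{x_{n-1}x_{m+2}-x_{n+2}x_{m-1}\}\cup\{x_0x_1x_{n-1}-x_{n+1}x_{e-1},\ x_0^2x_{n-1}-x_{n+1}x_{e-2},\ x_0^2x_{m-1}-x_{m+3}x_{e-4},\ x_0x_1x_{m-1}-x_{m+2}x_{e-2},\ x_1^3-x_4x_{e-1}\}$. 6. $K_{2,e-2}=\{x_{m+1}x_{n-2}-x_0x_{n+1}\}\cup\{x_{m+1}x_{m+1+j}-x_{m-1}x_{m+3+j}\mid j\in[0,e-m-4]\setminus\{n-m-3\}\}\cup\{x_{n-1}x_{n-1-j}-x_{n+1}x_{n-3-j}\mid j\in[0,n-m-4]\}\cup\{x_0x_1x_{n-1}-x_{n+1}x_{e-1},\ x_0^2x_{m-1}-x_{m+2}x_{e-3},\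 x_0x_1x_{m-1}-x_{m+3}x_{e-3},\ x_1^3-x_4x_{e-1}\}$. 7. $K_{3,4}=\{x_{n+1}x_{n+1+j}-x_{n-2}x_{n+4+j}\mid j\in[0,e-n-5]\}\cup\{x_0^2x_{m-1}-x_{m+3}x_{e-4},\ x_0x_1x_{m-1}-x_{m+3}x_{e-3},\ x_0x_2x_{n-2}-x_{n+2}x_{e-2},\ x_2^2x_1-x_6x_{e-1},\ x_2^3-x_7x_{e-1}\}$. 8. For $4\le m\le e-6$: $K_{m,m+1}=\{x_{n+1}x_{n+1+j}-x_{n-2}x_{n+4+j}\mid j\in[0,e-n-5]\}\cup\{x_{m-1}x_{m-1-j}-x_{m+2}x_{m-4-j}\mid j\in[0,m-4]\}\cup\{x_0^2x_{m-1}-x_{m+2}x_{e-3},\ x_0x_1x_{m-1}-x_{m+2}x_{e-2},\ x_0x_2x_{n-2}-x_{n+2}x_{e-2}\}$. 9. $K_{e-5,e-4}=\{x_{m-1}x_{m-1-j}-x_{m+2}x_{m-4-j}\mid j\in[0,m-4]\}\cup\{x_0^2x_{m-1}-x_{m+2}x_{e-3},\ x_0x_1x_{m-1}-x_{m+2}x_{e-2},\ x_0x_2x_{n-2}-x_{n+2}x_{e-2}\}$. 10. $K_{e-3,e-2}=\{x_{m-1}x_{m-1-j}-x_{m+2}x_{m-4-j}\mid j\in[0,m-4]\}\cup\{x_0x_2x_{n-2}-x_{n+1}x_{e-1}\}$. 11. For $3\le m\le e-6$: $K_{m,m+2}=\{x_{m+1}x_{m+1+j}-x_{m-1}x_{m+3+j}\mid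 j\in[0,e-m-4]\setminus\{1\}\}\cup\{x_{n+1}x_{n+1+j}-x_{n-1}x_{n+3+j}\mid j\in[0,e-n-4]\}\cup\{x_{n-1}x_{n-3-j}-x_{n+1}x_{n-5-j}\mid j\in[0,n-5]\}\cup\{x_{m-1}x_{m-1-j}-x_{m+1}x_{m-3-j}\mid j\in[0,m-3]\}\cup\{x_0^2x_{m-1}-x_{m+1}x_{e-2},\ x_0x_1x_{m-1}-x_{m+1}x_{e-1},\ x_0x_1x_{n-1}-x_{n+2}x_{e-2},\ x_0^2x_{n-1}-x_{n+2}x_{e-3}\}$. 12. $K_{e-5,e-3}=\{x_{m+1}^2-x_{m-1}x_{m+3}\}\cup\{x_{n-1}x_{n-3-j}-x_{n+1}x_{n-5-j}\mid j\in[0,n-5]\}\cup\{x_{m-1}x_{m-1-j}-x_{m+1}x_{m-3-j}\mid j\in[0,m-3]\}\cup\{x_0^2x_{m-1}-x_{m+1}x_{e-2},\ x_0x_1x_{m-1}-x_{m+1}x_{e-1},\ x_0x_1x_{n-1}-x_{n+2}x_{e-2},\ x_0^2x_{n-1}-x_{n+1}x_{e-2}\}$. 13. $K_{e-4,e-2}=\{x_{m+1}^2-x_{m-1}x_{m+3}\}\cup\{x_{n-1}x_{n-3-j}-x_{n+1}x_{n-5-j}\mid j\in[0,n-5]\}\cup\{x_{m-1}x_{m-1-j}-x_{m+1}x_{m-3-j}\mid j\in[0,m-3]\}\cup\{x_0x_1x_{m-1}-x_{m+1}x_{e-1},\ x_0x_1x_{n-1}-x_{n+1}x_{e-1}\}$.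 14. For $m\ge3$, $m+2<n\le e-4$: $K_{m,n}=\{x_{m+1}x_{n-2}-x_{m-2}x_{n+1}\}\cup\{x_{m+1}x_{m+1+j}-x_{m-1}x_{m+3+j}\mid j\in[0,e-m-4]\setminus\{n-m-1,n-m-3\}\}\cup\{x_{n+1}x_{n+1+j}-x_{n-1}x_{n+3+j}\mid j\in[0,e-n-4]\}\cup\{x_{n-1}x_{n-1-j}-x_{n+1}x_{n-3-j}\mid j\in[0,n-3]\setminus\{n-m-1,n-m-2,n-m-3\}\}\cup\{x_{n-1}x_{m+2}-x_{n+2}x_{m-1}\}\cup\{x_{m-1}x_{m-1-j}-x_{m+1}x_{m-3-j}\mid j\in[0,m-3]\}\cup\{x_0^2x_{m-1}-x_{m+2}x_{e-3},\ x_0x_1x_{m-1}-x_{m+2}x_{e-2},\ x_0x_1x_{n-1}-x_{n+2}x_{e-2},\ x_0^2x_{n-1}-x_{n+2}x_{e-3}\}$. 15. For $m\ge3$, $m+2<n=e-3$: $K_{m,n}=\{x_{m+1}x_{n-2}-x_{m-2}x_{n+1}\}\cup\{x_{m+1}x_{m+1+j}-x_{m-1}x_{m+3+j}\mid j\in[0,e-m-4]\setminus\{n-m-1,n-m-3\}\}\cup\{x_{n-1}x_{n-1-j}-x_{n+1}x_{n-3-j}\mid j\in[0,n-3]\setminus\{n-m-1,n-m-2,n-m-3\}\}\cup\{x_{n-1}x_{m+2}-x_{n+2}x_{m-1}\}\cup\{x_{m-1}x_{m-1-j}-x_{m+1}x_{m-3-j}\mid j\in[0,m-3]\}\cup\{x_0^2x_{m-1}-x_{m+1}x_{e-2},\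 x_0x_1x_{m-1}-x_{m+1}x_{e-1},\ x_0x_1x_{n-1}-x_{n+2}x_{e-2},\ x_0^2x_{n-1}-x_{n+1}x_{e-2}\}$. 16. For $m\ge3$, $m+2<n=e-2$: $K_{m,n}=\{x_{m+1}x_{n-2}-x_{m-2}x_{n+1}\}\cup\{x_{m+1}x_{m+1+j}-x_{m-1}x_{m+3+j}\mid j\in[0,e-m-4]\setminus\{n-m-3\}\}\cup\{x_{n-1}x_{n-1-j}-x_{n+1}x_{n-3-j}\mid j\in[0,n-3]\setminus\{n-m-1,n-m-2,n-m-3\}\}\cup\{x_{m-1}x_{m-1-j}-x_{m+1}x_{m-3-j}\mid j\in[0,m-3]\}\cup\{x_0^2x_{m-1}-x_{m+2}x_{e-3},\ x_0x_1x_{m-1}-x_{m+1}x_{e-1},\ x_0x_1x_{n-1}-x_{n+1}x_{e-1}\}$. **The set $G'_{S(e,m,n)}$.** - $m=1$: $\emptyset$ if $n\in\{2,3,e-2\}$; $\{x_0x_5x_{e-2}-x_2^2x_{e-1},\ x_2^2x_{e-2}-x_0x_3x_{e-1}\}$ if $n=4$; $\{x_0x_{n+1}x_{e-2}-x_2x_{n-2}x_{e-1}\}$ if $n\in[5,e-4]$; $\{x_{e-2}^3-x_{e-4}x_{e-1}^2,\ x_2x_{e-2}^2-x_0x_{e-1}^2,\ x_0x_{e-2}^2-x_2x_{e-5}x_{e-1}\}$ if $n=e-3$. - $m=2$: $\{x_0x_4x_{e-3}-x_1^2x_{e-1}\}$ if $n=3$; $\{x_0x_3x_{e-2}-x_1^2x_{e-1},\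 x_0x_{n+1}x_{e-2}-x_1x_{n-1}x_{e-1}\}$ if $n\in\{4,5\}$; $\{x_0x_{n+1}x_{e-2}-x_1x_{n-1}x_{e-1},\ x_0x_3x_{e-2}-x_1^2x_{e-1},\ x_1^2x_{n-1}-x_{n+2}x_{e-1}\}$ if $n\in[6,e-4]$; $\{x_{e-2}^3-x_{e-4}x_{e-1}^2,\ x_3x_{e-2}^2-x_1x_{e-1}^2,\ x_0x_{e-2}^2-x_1x_{e-4}x_{e-1},\ x_0x_3x_{e-2}-x_1^2x_{e-1},\ x_1^2x_{e-4}-x_{e-1}^2\}$ if $n=e-3$; $\{x_0x_4x_{e-3}-x_1^2x_{e-1},\ x_1^2x_{e-3}-x_0^2x_{e-1}\}$ if $n=e-2$. - $m\in[3,e-6]$: $\{x_0x_{m+2}x_{e-3}-x_1x_{m-1}x_{e-1},\ x_0x_{n+1}x_{e-2}-x_2x_{n-2}x_{e-1}\}$ if $n<e-3$ and $n=m+1$; $\{x_0x_{m+1}x_{e-2}-x_1x_{m-1}x_{e-1},\ x_0x_{n+1}x_{e-2}-x_1x_{n-1}x_{e-1}\}$ if $n<e-3$ and $n\ne m+1$; $\{x_{e-2}^3-x_{e-4}x_{e-1}^2,\ x_{m+1}x_{e-2}^2-x_{m-1}x_{e-1}^2,\ x_0x_{e-2}^2-x_1x_{e-4}x_{e-1},\ x_0x_{m+1}x_{e-2}-x_1x_{m-1}x_{e-1}\}$ if $n=e-3$; $\{x_0x_{m+2}x_{e-3}-x_1x_{m-1}x_{e-1}\}$ if $n=e-2$.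 - $m=e-5$: $\{x_{e-3}^2x_{e-2}-x_{e-6}x_{e-1}^2,\ x_0x_{e-3}x_{e-2}-x_2x_{e-6}x_{e-1},\ x_{e-3}^3-x_{e-7}x_{e-1}^2,\ x_0x_{e-3}^2-x_1x_{e-6}x_{e-1}\}$ if $n=e-4$; $\{x_{e-2}^3-x_{e-4}x_{e-1}^2,\ x_{e-4}x_{e-2}^2-x_{e-6}x_{e-1}^2,\ x_0x_{e-2}^2-x_1x_{e-4}x_{e-1},\ x_0x_{e-4}x_{e-2}-x_1x_{e-6}x_{e-1}\}$ if $n=e-3$; $\{x_{e-3}^3-x_{e-7}x_{e-1}^2,\ x_1x_{e-3}^2-x_0x_{e-4}x_{e-1},\ x_0x_{e-3}^2-x_1x_{e-6}x_{e-1}\}$ if $n=e-2$. - $(m,n)=(e-4,e-2)$ and $(m,n)=(e-3,e-2)$: $\emptyset$. *)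

(* Defs.v *)
From mathcomp Require Import all_boot all_order all_algebra.
From mathcomp Require Import mpoly.

Set Implicit Arguments.
Unset Strict Implicit.
Unset Printing Implicit Defensive.

Import GRing.Theory.
Local Open Scope ring_scope.

Section Groebner.

Variables (N : nat) (K : fieldType).
Implicit Types (p q : {mpoly K[N]}) (a b : 'X_{1..N}).

(* Graded reverse lexicographic order with 'X_0 > 'X_1 > ... > 'X_(N-1).  The
   order that mpoly puts on 'X_{1..N} (hence mlead) is degree-lexicographic:
   its documentation calls it degrevlex, but ltmcP compares the first variable
   whose exponents differ. *)
Definition grevlex_lt a b : bool :=
  (mdeg a < mdeg b)%N ||
  ((mdeg a == mdeg b) &&
   [exists i : 'I_N, (b i < a i)%N &&
      [forall j : 'I_N, (i < j)%N ==> (a j == b j)]]).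

(* A relation, so that 0 has no leading monomial. *)
Definition is_lead_monomial (lt : rel 'X_{1..N}) p a : Prop :=
  a \in msupp p /\ forall b, b \in msupp p -> b != a -> lt b a.

Definition ideal_gen (S : {mpoly K[N]} -> Prop) p : Prop :=
  exists2 s : seq ({mpoly K[N]} * {mpoly K[N]}),
    (forall c, c \in s -> S c.2) & p = \sum_(c <- s) c.1 * c.2.

Definition initial_ideal (lt : rel 'X_{1..N}) (S : {mpoly K[N]} -> Prop) :
    {mpoly K[N]} -> Prop :=
  ideal_gen (fun q => exists f a,
    [/\ S f, is_lead_monomial lt f a & q = 'X_[a]]).

Definition is_groebner_basis (lt : rel 'X_{1..N}) (G : seq {mpoly K[N]})
    (I : {mpoly K[N]} -> Prop) : Prop :=
  (forall g, g \in G -> I g) /\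
  (forall p, initial_ideal lt (fun g => g \in G) p <-> initial_ideal lt I p).

End Groebner.

Section Homogenization.

Variables (N : nat) (K : fieldType).

(* The homogenizing variable is the last one, 'X_ord_max, of {mpoly K[N.+1]};
   (msize f).-1 is the degree of f. *)
Definition homogenize (f : {mpoly K[N]}) : {mpoly K[N.+1]} :=
  \sum_(a <- msupp f)
    f@_a *: 'X_[mnmwiden a + U_(ord_max) *+ ((msize f).-1 - mdeg a)].

End Homogenization.

Definition closed_range (a b : nat) : seq nat := index_iota a b.+1.

Local Notation "[[ a , b ]]" := (closed_range a b)
  (at level 0, a at level 99, b at level 99).

Section Minors.

Variable (A : pzRingType).

Definition det2 (c d : A * A) : A := c.1 * d.2 - d.1 * c.2.

(* 2 x 2 minors of the 2-row matrix with the given list of columns. *)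
Fixpoint minors2 (cols : seq (A * A)) : seq A :=
  if cols is c :: cols' then [seq det2 c d | d <- cols'] ++ minors2 cols'
  else [::].

Definition minors2_first_col (cols : seq (A * A)) : seq A :=
  if cols is c :: cols' then [seq det2 c d | d <- cols'] else [::].

End Minors.

Section Semigroup.

Variables (K : fieldType) (e m n : nat).

(* For m < n, this enumerates {0, ..., e-1} \ {m, n} increasingly as k runs
   over 'I_(e - 2). *)
Definition var_index (k : nat) : nat := bump n (bump m k).

(* R(e,m,n) is {mpoly K[e - 2]}, the variable 'X_k standing for
   x_(var_index k), and R(e,m,n)[y] is {mpoly K[(e - 2).+1]}, where y is the
   last variable. *)

Definition semigroup_gen (k : 'I_(e - 2).+1) : nat * nat :=
  if unlift ord_max k is Some i then (e + var_index i, e - 1 - var_index i)%N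
  else (0, 2 * e - 1)%N.

Definition toric_map (f : {mpoly K[(e - 2).+1]}) : {mpoly K[2]} :=
  f \mPo [tuple 'X_ord0 ^+ (semigroup_gen k).1 * 'X_ord_max ^+ (semigroup_gen k).2
         | k < (e - 2).+1].

Definition toric_ideal (f : {mpoly K[(e - 2).+1]}) : Prop := toric_map f = 0.

(* x_i, for i < e distinct from m and n; the value 0 for other i is not used. *)
Definition xvar (i : nat) : {mpoly K[e - 2]} :=
  if [pick k : 'I_(e - 2) | var_index k == i] is Some k then 'X_k else 0.

Local Notation x := xvar.

Definition step_cols (s a b : nat) : seq ({mpoly K[e - 2]} * {mpoly K[e - 2]}) :=
  [seq (x i, x (i + s)) | i <- [[a, b]]].

(* In each definition below, for 10 <= e, 1 <= m < n <= e - 2 and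
   (m, n) <> (e - 4, e - 3), the range bounds, range exclusions and indices of
   the selected case involve no truncated subtraction. *)

Definition matA1 :=
  step_cols 1 2 (n - 2) ++ step_cols 1 (n + 1) (e - 2)
  ++ [:: (x (e - 1), x 0 ^+ 2)].

Definition matB :=
  if (n == 2)%N then
    (x 0, x 3) :: step_cols 3 3 (e - 4) ++ [:: (x (e - 3), x 0 ^+ 2)]
  else
    (x 0, x 2) :: step_cols 2 2 (n - 3)
    ++ (x (n - 1), x (n + 1)) :: step_cols 2 (n + 1) (e - 3)
    ++ (if n != (e - 2)%N then [:: (x (e - 2), x 0 ^+ 2)] else [::]).

Definition setL : seq {mpoly K[e - 2]} :=
  if (n == 2)%N then [::]
  else if (n == 3)%N then
    [seq x 4 * x (4 + i) - x 2 * x (6 + i) | i <- [[0, e - 7]]]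
    ++ [:: x 0 ^+ 2 * x 2 - x 4 * x (e - 2)]
  else if (n == 4)%N then
    [seq x 5 * x (5 + i) - x 3 * x (7 + i) | i <- [[0, e - 8]]]
    ++ [:: x 3 ^+ 2 - x 0 * x 6;
           x 0 ^+ 2 * x 3 - x 5 * x (e - 2);
           x 0 * x 2 ^+ 2 - x 5 * x (e - 1);
           x 2 ^+ 3 - x 7 * x (e - 1)]
  else if (5 <= n <= e - 4)%N then
    [seq x (n + 1) * x (n + 1 + i) - x (n - 1) * x (n + 3 + i)
       | i <- [[0, e - n - 4]]]
    ++ [seq x (n - 1) * x (n - 1 - i) - x (n + 1) * x (n - 3 - i)
          | i <- [[0, n - 5]]]
    ++ [:: x (n - 1) * x 3 - x (n + 2) * x 0;
           x 0 ^+ 2 * x (n - 1) - x (n + 1) * x (e - 2);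
           x 0 * x 2 * x (n - 2) - x (n + 1) * x (e - 1)]
  else if n == (e - 3)%N then
    [seq x (e - 4) * x (e - 4 - i) - x (e - 2) * x (e - 6 - i)
       | i <- [[0, e - 8]]]
    ++ [:: x (e - 4) * x 3 - x 0 * x (e - 1);
           x 0 ^+ 2 * x (e - 4) - x (e - 2) ^+ 2;
           x 0 * x 2 * x (e - 5) - x (e - 2) * x (e - 1)]
  else if n == (e - 2)%N then
    [seq x (e - 3) * x (e - 3 - i) - x (e - 1) * x (e - 5 - i)
       | i <- [[0, e - 7]]]
    ++ [:: x 0 ^+ 3 - x 3 * x (e - 3);
           x 0 * x 2 * x (e - 4) - x (e - 1) ^+ 2]
  else [::].

Definition matA2 :=
  step_cols 1 0 (m - 2) ++ step_cols 1 (m + 1) (n - 2)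
  ++ step_cols 1 (n + 1) (e - 2) ++ [:: (x (e - 1), x 0 ^+ 2)].

Definition setK : seq {mpoly K[e - 2]} :=
  if (m == 2)%N && (n == 3)%N then
    [seq x (n + 1) * x (n + 1 + j) - x (n - 2) * x (n + 4 + j)
       | j <- [[0, e - n - 5]]]
    ++ [:: x 0 ^+ 2 * x (m - 1) - x (m + 3) * x (e - 4);
           x 0 * x 1 * x (m - 1) - x (m + 3) * x (e - 3);
           x 1 ^+ 3 - x 4 * x (e - 1)]
  else if (m == 2)%N && (n == 4)%N then
    [seq x (m + 1) * x (m + 1 + j) - x (m - 1) * x (m + 3 + j)
       | j <- [[0, e - m - 4]] & j != 1%N]
    ++ [seq x (n + 1) * x (n + 1 + j) - x (n - 1) * x (n + 3 + j)
          | j <- [[0, e - n - 4]]]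
    ++ [:: x 0 ^+ 2 * x (m - 1) - x (m + 1) * x (e - 2);
           x 0 * x 1 * x (m - 1) - x (m + 1) * x (e - 1);
           x 0 * x 1 * x (n - 1) - x (n + 2) * x (e - 2);
           x 0 ^+ 2 * x (n - 1) - x (n + 2) * x (e - 3);
           x 1 ^+ 3 - x 6 * x (e - 3);
           x 1 ^+ 2 * x (n - 1) - x (n + 2) * x (e - 1)]
  else if (m == 2)%N && (n == 5)%N then
    [:: x (m + 1) ^+ 2 - x (m - 2) * x (m + 4)]
    ++ [seq x (m + 1) * x (m + 1 + j) - x (m - 1) * x (m + 3 + j)
          | j <- [[1, e - m - 4]] & j != 2%N]
    ++ [seq x (n + 1) * x (n + 1 + j) - x (n - 1) * x (n + 3 + j)
          | j <- [[0, e - n - 4]]]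
    ++ [:: x (n - 1) ^+ 2 - x (n + 2) * x (n - 4)]
    ++ [:: x 0 * x 1 * x (n - 1) - x (n + 2) * x (e - 2);
           x 0 ^+ 2 * x (n - 1) - x (n + 2) * x (e - 3);
           x 1 ^+ 2 * x (n - 1) - x (n + 2) * x (e - 1);
           x 0 ^+ 2 * x (m - 1) - x (m + 2) * x (e - 3);
           x 0 * x 1 * x (m - 1) - x (m + 2) * x (e - 2);
           x 1 ^+ 3 - x 4 * x (e - 1)]
  else if (m == 2)%N && (6 <= n <= e - 4)%N then
    [:: x (m + 1) * x (n - 2) - x 0 * x (n + 1)]
    ++ [seq x (m + 1) * x (m + 1 + j) - x (m - 1) * x (m + 3 + j)
          | j <- [[0, e - m - 4]] & j \notin [:: n - m - 1; n - m - 3]%N]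
    ++ [seq x (n + 1) * x (n + 1 + j) - x (n - 1) * x (n + 3 + j)
          | j <- [[0, e - n - 4]]]
    ++ [seq x (n - 1) * x (n - 1 - j) - x (n + 1) * x (n - 3 - j)
          | j <- [[0, n - m - 4]]]
    ++ [:: x (n - 1) * x (m + 2) - x (n + 2) * x (m - 1)]
    ++ [:: x 0 * x 1 * x (n - 1) - x (n + 2) * x (e - 2);
           x 0 ^+ 2 * x (n - 1) - x (n + 2) * x (e - 3);
           x 0 ^+ 2 * x (m - 1) - x (m + 2) * x (e - 3);
           x 0 * x 1 * x (m - 1) - x (m + 2) * x (e - 2);
           x 1 ^+ 3 - x 4 * x (e - 1)]
  else if (m == 2)%N && (n == e - 3)%N then
    [:: x (m + 1) * x (n - 2) - x 0 * x (n + 1)]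
    ++ [seq x (m + 1) * x (m + 1 + j) - x (m - 1) * x (m + 3 + j)
          | j <- [[0, e - m - 5]] & j != (n - m - 3)%N]
    ++ [seq x (n - 1) * x (n - 1 - j) - x (n + 1) * x (n - 3 - j)
          | j <- [[0, n - m - 4]]]
    ++ [:: x (n - 1) * x (m + 2) - x (n + 2) * x (m - 1)]
    ++ [:: x 0 * x 1 * x (n - 1) - x (n + 1) * x (e - 1);
           x 0 ^+ 2 * x (n - 1) - x (n + 1) * x (e - 2);
           x 0 ^+ 2 * x (m - 1) - x (m + 3) * x (e - 4);
           x 0 * x 1 * x (m - 1) - x (m + 2) * x (e - 2);
           x 1 ^+ 3 - x 4 * x (e - 1)]
  else if (m == 2)%N && (n == e - 2)%N then
    [:: x (m + 1) * x (n - 2) - x 0 * x (n + 1)]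
    ++ [seq x (m + 1) * x (m + 1 + j) - x (m - 1) * x (m + 3 + j)
          | j <- [[0, e - m - 4]] & j != (n - m - 3)%N]
    ++ [seq x (n - 1) * x (n - 1 - j) - x (n + 1) * x (n - 3 - j)
          | j <- [[0, n - m - 4]]]
    ++ [:: x 0 * x 1 * x (n - 1) - x (n + 1) * x (e - 1);
           x 0 ^+ 2 * x (m - 1) - x (m + 2) * x (e - 3);
           x 0 * x 1 * x (m - 1) - x (m + 3) * x (e - 3);
           x 1 ^+ 3 - x 4 * x (e - 1)]
  else if (m == 3)%N && (n == 4)%N then
    [seq x (n + 1) * x (n + 1 + j) - x (n - 2) * x (n + 4 + j)
       | j <- [[0, e - n - 5]]]
    ++ [:: x 0 ^+ 2 * x (m - 1) - x (m + 3) * x (e - 4);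
           x 0 * x 1 * x (m - 1) - x (m + 3) * x (e - 3);
           x 0 * x 2 * x (n - 2) - x (n + 2) * x (e - 2);
           x 2 ^+ 2 * x 1 - x 6 * x (e - 1);
           x 2 ^+ 3 - x 7 * x (e - 1)]
  else if (4 <= m <= e - 6)%N && (n == m + 1)%N then
    [seq x (n + 1) * x (n + 1 + j) - x (n - 2) * x (n + 4 + j)
       | j <- [[0, e - n - 5]]]
    ++ [seq x (m - 1) * x (m - 1 - j) - x (m + 2) * x (m - 4 - j)
          | j <- [[0, m - 4]]]
    ++ [:: x 0 ^+ 2 * x (m - 1) - x (m + 2) * x (e - 3);
           x 0 * x 1 * x (m - 1) - x (m + 2) * x (e - 2);
           x 0 * x 2 * x (n - 2) - x (n + 2) * x (e - 2)]
  else if (m == e - 5)%N && (n == e - 4)%N then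
    [seq x (m - 1) * x (m - 1 - j) - x (m + 2) * x (m - 4 - j)
       | j <- [[0, m - 4]]]
    ++ [:: x 0 ^+ 2 * x (m - 1) - x (m + 2) * x (e - 3);
           x 0 * x 1 * x (m - 1) - x (m + 2) * x (e - 2);
           x 0 * x 2 * x (n - 2) - x (n + 2) * x (e - 2)]
  else if (m == e - 3)%N && (n == e - 2)%N then
    [seq x (m - 1) * x (m - 1 - j) - x (m + 2) * x (m - 4 - j)
       | j <- [[0, m - 4]]]
    ++ [:: x 0 * x 2 * x (n - 2) - x (n + 1) * x (e - 1)]
  else if (3 <= m <= e - 6)%N && (n == m + 2)%N then
    [seq x (m + 1) * x (m + 1 + j) - x (m - 1) * x (m + 3 + j)
       | j <- [[0, e - m - 4]] & j != 1%N]
    ++ [seq x (n + 1) * x (n + 1 + j) - x (n - 1) * x (n + 3 + j)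
          | j <- [[0, e - n - 4]]]
    ++ [seq x (n - 1) * x (n - 3 - j) - x (n + 1) * x (n - 5 - j)
          | j <- [[0, n - 5]]]
    ++ [seq x (m - 1) * x (m - 1 - j) - x (m + 1) * x (m - 3 - j)
          | j <- [[0, m - 3]]]
    ++ [:: x 0 ^+ 2 * x (m - 1) - x (m + 1) * x (e - 2);
           x 0 * x 1 * x (m - 1) - x (m + 1) * x (e - 1);
           x 0 * x 1 * x (n - 1) - x (n + 2) * x (e - 2);
           x 0 ^+ 2 * x (n - 1) - x (n + 2) * x (e - 3)]
  else if (m == e - 5)%N && (n == e - 3)%N then
    [:: x (m + 1) ^+ 2 - x (m - 1) * x (m + 3)]
    ++ [seq x (n - 1) * x (n - 3 - j) - x (n + 1) * x (n - 5 - j)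
          | j <- [[0, n - 5]]]
    ++ [seq x (m - 1) * x (m - 1 - j) - x (m + 1) * x (m - 3 - j)
          | j <- [[0, m - 3]]]
    ++ [:: x 0 ^+ 2 * x (m - 1) - x (m + 1) * x (e - 2);
           x 0 * x 1 * x (m - 1) - x (m + 1) * x (e - 1);
           x 0 * x 1 * x (n - 1) - x (n + 2) * x (e - 2);
           x 0 ^+ 2 * x (n - 1) - x (n + 1) * x (e - 2)]
  else if (m == e - 4)%N && (n == e - 2)%N then
    [:: x (m + 1) ^+ 2 - x (m - 1) * x (m + 3)]
    ++ [seq x (n - 1) * x (n - 3 - j) - x (n + 1) * x (n - 5 - j)
          | j <- [[0, n - 5]]]
    ++ [seq x (m - 1) * x (m - 1 - j) - x (m + 1) * x (m - 3 - j)
          | j <- [[0, m - 3]]]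
    ++ [:: x 0 * x 1 * x (m - 1) - x (m + 1) * x (e - 1);
           x 0 * x 1 * x (n - 1) - x (n + 1) * x (e - 1)]
  else if (3 <= m)%N && (m + 2 < n <= e - 4)%N then
    [:: x (m + 1) * x (n - 2) - x (m - 2) * x (n + 1)]
    ++ [seq x (m + 1) * x (m + 1 + j) - x (m - 1) * x (m + 3 + j)
          | j <- [[0, e - m - 4]] & j \notin [:: n - m - 1; n - m - 3]%N]
    ++ [seq x (n + 1) * x (n + 1 + j) - x (n - 1) * x (n + 3 + j)
          | j <- [[0, e - n - 4]]]
    ++ [seq x (n - 1) * x (n - 1 - j) - x (n + 1) * x (n - 3 - j)
          | j <- [[0, n - 3]]
          & j \notin [:: n - m - 1; n - m - 2; n - m - 3]%N]
    ++ [:: x (n - 1) * x (m + 2) - x (n + 2) * x (m - 1)]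
    ++ [seq x (m - 1) * x (m - 1 - j) - x (m + 1) * x (m - 3 - j)
          | j <- [[0, m - 3]]]
    ++ [:: x 0 ^+ 2 * x (m - 1) - x (m + 2) * x (e - 3);
           x 0 * x 1 * x (m - 1) - x (m + 2) * x (e - 2);
           x 0 * x 1 * x (n - 1) - x (n + 2) * x (e - 2);
           x 0 ^+ 2 * x (n - 1) - x (n + 2) * x (e - 3)]
  else if (3 <= m)%N && (m + 2 < n)%N && (n == e - 3)%N then
    [:: x (m + 1) * x (n - 2) - x (m - 2) * x (n + 1)]
    ++ [seq x (m + 1) * x (m + 1 + j) - x (m - 1) * x (m + 3 + j)
          | j <- [[0, e - m - 4]] & j \notin [:: n - m - 1; n - m - 3]%N]
    ++ [seq x (n - 1) * x (n - 1 - j) - x (n + 1) * x (n - 3 - j)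
          | j <- [[0, n - 3]]
          & j \notin [:: n - m - 1; n - m - 2; n - m - 3]%N]
    ++ [:: x (n - 1) * x (m + 2) - x (n + 2) * x (m - 1)]
    ++ [seq x (m - 1) * x (m - 1 - j) - x (m + 1) * x (m - 3 - j)
          | j <- [[0, m - 3]]]
    ++ [:: x 0 ^+ 2 * x (m - 1) - x (m + 1) * x (e - 2);
           x 0 * x 1 * x (m - 1) - x (m + 1) * x (e - 1);
           x 0 * x 1 * x (n - 1) - x (n + 2) * x (e - 2);
           x 0 ^+ 2 * x (n - 1) - x (n + 1) * x (e - 2)]
  else if (3 <= m)%N && (m + 2 < n)%N && (n == e - 2)%N then
    [:: x (m + 1) * x (n - 2) - x (m - 2) * x (n + 1)]
    ++ [seq x (m + 1) * x (m + 1 + j) - x (m - 1) * x (m + 3 + j)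
          | j <- [[0, e - m - 4]] & j != (n - m - 3)%N]
    ++ [seq x (n - 1) * x (n - 1 - j) - x (n + 1) * x (n - 3 - j)
          | j <- [[0, n - 3]]
          & j \notin [:: n - m - 1; n - m - 2; n - m - 3]%N]
    ++ [seq x (m - 1) * x (m - 1 - j) - x (m + 1) * x (m - 3 - j)
          | j <- [[0, m - 3]]]
    ++ [:: x 0 ^+ 2 * x (m - 1) - x (m + 2) * x (e - 3);
           x 0 * x 1 * x (m - 1) - x (m + 1) * x (e - 1);
           x 0 * x 1 * x (n - 1) - x (n + 1) * x (e - 1)]
  else [::].

Definition setG : seq {mpoly K[e - 2]} :=
  if (m == 1)%N then minors2 matA1 ++ minors2_first_col matB ++ setL
  else minors2 matA2 ++ setK.

Definition setG' : seq {mpoly K[e - 2]} :=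
  if (m == 1)%N then
    if n \in [:: 2; 3; e - 2]%N then [::]
    else if (n == 4)%N then
      [:: x 0 * x 5 * x (e - 2) - x 2 ^+ 2 * x (e - 1);
          x 2 ^+ 2 * x (e - 2) - x 0 * x 3 * x (e - 1)]
    else if (5 <= n <= e - 4)%N then
      [:: x 0 * x (n + 1) * x (e - 2) - x 2 * x (n - 2) * x (e - 1)]
    else if n == (e - 3)%N then
      [:: x (e - 2) ^+ 3 - x (e - 4) * x (e - 1) ^+ 2;
          x 2 * x (e - 2) ^+ 2 - x 0 * x (e - 1) ^+ 2;
          x 0 * x (e - 2) ^+ 2 - x 2 * x (e - 5) * x (e - 1)]
    else [::]
  else if (m == 2)%N then
    if (n == 3)%N then
      [:: x 0 * x 4 * x (e - 3) - x 1 ^+ 2 * x (e - 1)]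
    else if n \in [:: 4; 5]%N then
      [:: x 0 * x 3 * x (e - 2) - x 1 ^+ 2 * x (e - 1);
          x 0 * x (n + 1) * x (e - 2) - x 1 * x (n - 1) * x (e - 1)]
    else if (6 <= n <= e - 4)%N then
      [:: x 0 * x (n + 1) * x (e - 2) - x 1 * x (n - 1) * x (e - 1);
          x 0 * x 3 * x (e - 2) - x 1 ^+ 2 * x (e - 1);
          x 1 ^+ 2 * x (n - 1) - x (n + 2) * x (e - 1)]
    else if n == (e - 3)%N then
      [:: x (e - 2) ^+ 3 - x (e - 4) * x (e - 1) ^+ 2;
          x 3 * x (e - 2) ^+ 2 - x 1 * x (e - 1) ^+ 2;
          x 0 * x (e - 2) ^+ 2 - x 1 * x (e - 4) * x (e - 1);
          x 0 * x 3 * x (e - 2) - x 1 ^+ 2 * x (e - 1);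
          x 1 ^+ 2 * x (e - 4) - x (e - 1) ^+ 2]
    else if n == (e - 2)%N then
      [:: x 0 * x 4 * x (e - 3) - x 1 ^+ 2 * x (e - 1);
          x 1 ^+ 2 * x (e - 3) - x 0 ^+ 2 * x (e - 1)]
    else [::]
  else if (3 <= m <= e - 6)%N then
    if (n < e - 3)%N && (n == m + 1)%N then
      [:: x 0 * x (m + 2) * x (e - 3) - x 1 * x (m - 1) * x (e - 1);
          x 0 * x (n + 1) * x (e - 2) - x 2 * x (n - 2) * x (e - 1)]
    else if (n < e - 3)%N && (n != m + 1)%N then
      [:: x 0 * x (m + 1) * x (e - 2) - x 1 * x (m - 1) * x (e - 1);
          x 0 * x (n + 1) * x (e - 2) - x 1 * x (n - 1) * x (e - 1)]
    else if n == (e - 3)%N then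
      [:: x (e - 2) ^+ 3 - x (e - 4) * x (e - 1) ^+ 2;
          x (m + 1) * x (e - 2) ^+ 2 - x (m - 1) * x (e - 1) ^+ 2;
          x 0 * x (e - 2) ^+ 2 - x 1 * x (e - 4) * x (e - 1);
          x 0 * x (m + 1) * x (e - 2) - x 1 * x (m - 1) * x (e - 1)]
    else if n == (e - 2)%N then
      [:: x 0 * x (m + 2) * x (e - 3) - x 1 * x (m - 1) * x (e - 1)]
    else [::]
  else if m == (e - 5)%N then
    if n == (e - 4)%N then
      [:: x (e - 3) ^+ 2 * x (e - 2) - x (e - 6) * x (e - 1) ^+ 2;
          x 0 * x (e - 3) * x (e - 2) - x 2 * x (e - 6) * x (e - 1);
          x (e - 3) ^+ 3 - x (e - 7) * x (e - 1) ^+ 2;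
          x 0 * x (e - 3) ^+ 2 - x 1 * x (e - 6) * x (e - 1)]
    else if n == (e - 3)%N then
      [:: x (e - 2) ^+ 3 - x (e - 4) * x (e - 1) ^+ 2;
          x (e - 4) * x (e - 2) ^+ 2 - x (e - 6) * x (e - 1) ^+ 2;
          x 0 * x (e - 2) ^+ 2 - x 1 * x (e - 4) * x (e - 1);
          x 0 * x (e - 4) * x (e - 2) - x 1 * x (e - 6) * x (e - 1)]
    else if n == (e - 2)%N then
      [:: x (e - 3) ^+ 3 - x (e - 7) * x (e - 1) ^+ 2;
          x 1 * x (e - 3) ^+ 2 - x 0 * x (e - 4) * x (e - 1);
          x 0 * x (e - 3) ^+ 2 - x 1 * x (e - 6) * x (e - 1)]
    else [::]
  else [::].

Definition calG : seq {mpoly K[e - 2]} := setG ++ setG'.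

Definition calG_hom : seq {mpoly K[(e - 2).+1]} :=
  [seq homogenize f | f <- calG].

End Semigroup.

(* Main.v *)
Require Import Defs.
From mathcomp Require Import all_boot all_order all_algebra.
From mathcomp Require Import mpoly.
From mathcomp Require Import zify.

Import GRing.Theory.

(** The map whose kernel is the toric ideal I sends a monomial to a monomial,
    with exponent vector the bidegree of the source. So every monomial of an
    element of I shares its bidegree with another monomial of that element
    ([toric_cancel]). For a finite set G contained in such an ideal it is enough
    that, of any two distinct monomials of the same bidegree, one is divisible by
    a leading monomial of an element of G ([groebner_of_fibers]).

    A monomial is a power of y times the product of the x_i for i in a list of
    indices. Up to the degree, its bidegree is the value of the list, the sum of
    the e + i. The variable y contributes 0 to the value and x_(e-1) contributes
    2e - 1. The leading monomials used below contain neither of these two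
    variables, so one may strip both from a monomial, and then the bidegree
    determines the value of the stripped list modulo 2e - 1. It remains to find a
    class of standard lists such that

    - every stripped list that is not standard contains, as a sublist, the leading
      monomial of an element of the basis ([reducible_or_standard]);
    - different standard lists have values that are different modulo 2e - 1
      ([standard_value_inj]).

    If i - d and j + d are both indices of variables for some d > 0, then x_i x_j
    is the leading monomial of x_i x_j - x_(i-d) x_(j+d), and the pair (i, j) is
    called widenable. The standard lists are the lists of size at most one, the
    pairs that are not widenable and a few exceptional triples. After padding with
    e - 1, the lists of size at most two become pairs of indices, and the residue
    of the value becomes the sum of the two indices, which runs through the
    2e - 1 numbers from 0 to 2e - 2. A sum of two indices is attained by exactly
    one pair that is not widenable. The indices m and n are missing, so for some m
    and n there are numbers that are not such a sum, and these are the residues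
    of the exceptional triples.

    For the first point, the two missing indices forbid few values of d, so a
    widenable pair can be widened by some d <= 3 ([widenable_small]). For d = 1 it
    is the leading monomial of a minor of A, and for d = 2, 3 of a minor of B or of
    a quadratic element of L or K ([widenable_leads]). A pair that is not widenable
    has one of six shapes ([pair_shapeP]), so a triple without a widenable pair
    has one of thirteen ([triple_shapeP]), and each of them is exceptional or the
    leading monomial of a cubic element of the basis ([triple_leads]). Four
    indices always contain a widenable pair or such a cubic monomial.

    The generators themselves are differences of two monomials of equal value
    ([calG_binomial]), so their homogenizations are in I ([is_binomial_toric]).
*)

Set Implicit Arguments.
Unset Strict Implicit.
Unset Printing Implicit Defensive.

(** * A criterion for Groebner bases of ideals with a cancellation property *)
Section Criterion.

Local Open Scope ring_scope.

Variables (N : nat) (K : fieldType) (lt : rel 'X_{1..N}).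
Implicit Types (p q : {mpoly K[N]}) (a b c d : 'X_{1..N}).

Lemma ideal_gen_mono (S S' : {mpoly K[N]} -> Prop) p :
  (forall q, S q -> S' q) -> ideal_gen S p -> ideal_gen S' p.
Proof. by move=> SS' [s sS ->]; exists s => // c /sS /SS'. Qed.

Lemma ideal_gen0 (S : {mpoly K[N]} -> Prop) : ideal_gen S 0.
Proof. by exists [::]; rewrite ?big_nil. Qed.

Lemma ideal_genD (S : {mpoly K[N]} -> Prop) p q :
  ideal_gen S p -> ideal_gen S q -> ideal_gen S (p + q).
Proof.
move=> [s sS ->] [t tS ->]; exists (s ++ t); last by rewrite big_cat.
by move=> c; rewrite mem_cat => /orP [/sS|/tS].
Qed.

Lemma ideal_genM (S : {mpoly K[N]} -> Prop) p q : S q -> ideal_gen S (p * q).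
Proof.
by move=> Sq; exists [:: (p, q)]; rewrite ?big_seq1 // => c /[!inE]/eqP->.
Qed.

Variables (T : eqType) (psi : 'X_{1..N} -> T).
Variables (G : seq {mpoly K[N]}) (I : {mpoly K[N]} -> Prop).

Hypothesis lt_irr : irreflexive lt.
Hypothesis lt_trans : transitive lt.
Hypothesis ltD : forall a b d, lt a b -> lt (a + d)%MM (b + d)%MM.
Hypothesis psiD :
  forall a b d, psi a = psi b -> psi (a + d)%MM = psi (b + d)%MM.
Hypothesis psi_mdeg : forall a b, psi a = psi b -> mdeg a = mdeg b.

Lemma fiber_min a : exists b,
  [/\ psi b = psi a, (b == a) || lt b a
    & forall c, psi c = psi a -> ~~ lt c b].
Proof.
(* Monomials with the same psi have the same degree, so the fibre is finite;
   descend on the number of its elements below x. *)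
pose below x := [set c : 'X_{1..N < (mdeg a).+1} | lt c x && (psi c == psi a)].
suff: forall n x, (#|below x| <= n)%N -> psi x = psi a -> (x == a) || lt x a ->
    exists b, [/\ psi b = psi a, (b == a) || lt b a
                & forall c, psi c = psi a -> ~~ lt c b].
  by move/(_ _ a (leqnn _)); apply; rewrite ?eqxx.
elim=> [|n IHn] x le_n psi_x le_xa.
  exists x; split=> // c psi_c; apply/negP => lt_cx.
  have lt_c : (mdeg c < (mdeg a).+1)%N by rewrite (psi_mdeg psi_c).
  move: le_n; rewrite leqn0 cards_eq0 => /eqP/setP/(_ (BMultinom lt_c)).
  by rewrite !inE /= lt_cx psi_c eqxx.
have [|] := boolP [exists c : 'X_{1..N < (mdeg a).+1},
                     lt c x && (psi c == psi a)]; last first.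
  rewrite negb_exists => /forallP x_min; exists x; split=> // c psi_c.
  have lt_c : (mdeg c < (mdeg a).+1)%N by rewrite (psi_mdeg psi_c).
  by have := x_min (BMultinom lt_c); rewrite /= psi_c eqxx andbT.
case/existsP => c /andP [lt_cx /eqP psi_c]; apply: (IHn c) => //.
  rewrite -ltnS; apply: leq_trans le_n; apply/proper_card/properP; split.
    by apply/subsetP => d; rewrite !inE => /andP [/lt_trans->].
  by exists c; rewrite !inE ?lt_irr ?lt_cx ?psi_c /= ?eqxx.
case/orP: le_xa => [/eqP eq_xa|/(lt_trans lt_cx) ->]; last by rewrite orbT.
by rewrite -[X in lt _ X]eq_xa lt_cx orbT.
Qed.

Hypothesis subGI : forall g, g \in G -> I g.
Hypothesis I_cancel : forall p a, I p -> a \in msupp p ->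
  exists b, [/\ b \in msupp p, b != a & psi b = psi a].
Hypothesis G_sep : forall a b, psi a = psi b -> a != b ->
  exists g c, [/\ g \in G, is_lead_monomial lt g c & (c <= a)%MM || (c <= b)%MM].

(** Apply the separation property to a and the least monomial b with the same
    psi. No leading monomial c of an element g of G divides b: in g, the monomial
    c has a companion c' with the same psi, and replacing the factor c of b by c'
    would give a monomial below b. So c divides a. *)
Lemma lead_divisible p a : I p -> is_lead_monomial lt p a ->
  exists g c, [/\ g \in G, is_lead_monomial lt g c & (c <= a)%MM].
Proof.
move=> Ip [pa a_max]; have [b [psi_b _ b_min]] := fiber_min a.
have [a' [pa' neq_a'a psi_a']] := I_cancel Ip pa.
have neq_ab : a != b.
  by apply: contraTneq (a_max _ pa' neq_a'a) => ->; apply: b_min.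
have [g [c [Gg gc /orP [le_ca|le_cb]]]] := G_sep (esym psi_b) neq_ab.
  by exists g, c.
case: (gc) => g_c c_max.
have [c' [g_c' neq_c'c psi_c']] := I_cancel (subGI Gg) g_c.
have b_eq : (c + (b - c))%MM = b by rewrite addmC submK.
have := b_min (c' + (b - c))%MM; rewrite (psiD _ psi_c') b_eq => /(_ psi_b).
by rewrite -[X in lt _ X]b_eq ltD // c_max.
Qed.

(** By [lead_divisible], each generator of the initial ideal of I is a multiple of
    a generator of the initial ideal of G. *)
Lemma groebner_of_fibers : is_groebner_basis lt G I.
Proof.
split=> // p; split.
  by apply: ideal_gen_mono => q [f [a [Gf fa ->]]]; exists f, a; split; auto.
case=> s sI ->; elim: s sI => [|[u v] s IHs] sI.
  by rewrite big_nil; apply: ideal_gen0.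
rewrite big_cons; apply: ideal_genD; last first.
  by apply: IHs => c cs; apply: sI; rewrite inE cs orbT.
have [f [a [If fa /= ->]]] := sI _ (mem_head _ _).
have [g [c [Gg gc le_ca]]] := lead_divisible If fa.
rewrite -(submK le_ca) mpolyXD mulrA; apply: ideal_genM.
by exists g, c.
Qed.

End Criterion.

(** * The graded reverse lexicographic order and homogenized binomials *)
Section Grevlex.

Variable N : nat.
Implicit Types (a b c d : 'X_{1..N}).

Lemma grevlex_irr : irreflexive (@grevlex_lt N).
Proof.
move=> a; rewrite /grevlex_lt ltnn eqxx /=; apply/negbTE/existsPn => i.
by rewrite ltnn.
Qed.

Lemma grevlex_trans : transitive (@grevlex_lt N).
Proof.
move=> b a c; rewrite /grevlex_lt => /orP [lt_ab|/andP [/eqP -> /existsP]].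
  by case/orP=> [/(ltn_trans lt_ab) -> //|/andP [/eqP <-]]; rewrite lt_ab.
case=> i /andP [lt_i /forallP eq_i] /orP [-> //|/andP [->]] /=.
case/existsP=> j /andP [lt_j /forallP eq_j]; apply/orP; right.
apply/existsP; exists (if (i < j)%N then j else i).
have [lt_ij|le_ji] := ltnP i j; apply/andP; split.
- by have /implyP/(_ lt_ij)/eqP -> := eq_i j.
- apply/forallP => k; apply/implyP => lt_jk.
  have /implyP/(_ (ltn_trans lt_ij lt_jk))/eqP -> := eq_i k.
  by have /implyP/(_ lt_jk) := eq_j k.
- move: le_ji; rewrite leq_eqVlt => /orP [/eqP/val_inj eq_ji|lt_ji].
    by apply: ltn_trans lt_i; rewrite -eq_ji.
  by have /implyP/(_ lt_ji)/eqP <- := eq_j i.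
- apply/forallP => k; apply/implyP => lt_ik.
  have /implyP/(_ lt_ik)/eqP -> := eq_i k.
  by have /implyP/(_ (leq_ltn_trans le_ji lt_ik)) := eq_j k.
Qed.

Lemma grevlexD a b d : grevlex_lt a b -> grevlex_lt (a + d)%MM (b + d)%MM.
Proof.
rewrite /grevlex_lt !mdegD ltn_add2r eqn_add2r.
case/orP=> [-> //|/andP [-> /existsP [i /andP [lt_i /forallP eq_i]]]] /=.
apply/orP; right; apply/existsP; exists i; rewrite !mnmDE ltn_add2r lt_i /=.
by apply/forallP => j; rewrite !mnmDE eqn_add2r.
Qed.

End Grevlex.

Section HomogenizeBinomial.

Local Open Scope ring_scope.

Variables (N : nat) (K : fieldType).
Implicit Types (a b : 'X_{1..N}) (f : {mpoly K[N]}).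

Lemma homogenize0 : homogenize (0 : {mpoly K[N]}) = 0.
Proof. by rewrite /homogenize (msuppC N (0 : K)) eqxx big_nil. Qed.

Lemma homogenizeN f : homogenize (- f) = - homogenize f.
Proof.
rewrite /homogenize mmeasureN (perm_big _ (msuppN f)) -sumrN /=.
by apply: eq_bigr => a _; rewrite mcoeffN scaleNr.
Qed.

Lemma msupp_binomial a b : a != b ->
  perm_eq (msupp ('X_[a] - 'X_[b] : {mpoly K[N]})) [:: a; b].
Proof.
move=> neq_ab; rewrite (perm_trans (msuppD _)) //.
  move=> c; rewrite /= (perm_mem (msuppN _)) !msuppX !inE.
  by case: eqP => // ->; rewrite (negbTE neq_ab).
by rewrite msuppX (perm_cat2l [:: a] _ [:: b]) (perm_trans (msuppN _)) // msuppX.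
Qed.

Lemma homogenize_binomial a b : a != b -> (mdeg b <= mdeg a)%N ->
  homogenize ('X_[a] - 'X_[b] : {mpoly K[N]}) =
    'X_[mnmwiden a] - 'X_[(mnmwiden b + U_(ord_max) *+ (mdeg a - mdeg b))%MM].
Proof.
move=> neq_ab le_ba; rewrite /homogenize msizeE.
rewrite !(perm_big _ (msupp_binomial neq_ab)) !big_cons !big_nil /=.
rewrite maxn0 (maxn_idPl _) ?ltnS //= !mcoeffB !mcoeffX !eqxx addr0.
rewrite [b == a]eq_sym (negbTE neq_ab) subr0 sub0r scale1r scaleN1r.
by rewrite subnn mulm0n addm0.
Qed.

End HomogenizeBinomial.

(** * Monomials as lists of indices *)
(** For i < e, the indices of the variables x_i. *)
Definition avail (e m n i : nat) : bool := [&& i < e, i != m & i != n].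

Section Encoding.

Variables (e m n : nat).
Hypotheses (hmn : m < n) (hn : n <= e - 2) (he : 1 < e).
Implicit Types (s t u : seq nat) (k : 'I_(e - 2)).

Local Notation avail := (avail e m n).
Local Notation var := (var_index m n).

Lemma var_avail k : avail (var k).
Proof.
have lt_k := ltn_ord k; rewrite /avail /var_index /bump.
by case: (leqP m k) => ?; case: leqP => ?; apply/and3P; split; lia.
Qed.

Lemma var_inj : injective (fun k => var k).
Proof. by move=> j k /(can_inj (bumpK n))/(can_inj (bumpK m))/val_inj. Qed.

Lemma avail_var i : avail i -> exists k, var k = i.
Proof.
case/and3P => lt_i neq_m neq_n.
have lt_k : unbump m (unbump n i) < e - 2.
  by rewrite /unbump; case: (ltnP n i) => ?; case: ltnP => ?; lia.
exists (Ordinal lt_k); rewrite /var_index /= !unbumpKcond.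
by rewrite /unbump /bump; case: (ltnP n i) => ?; case: eqP => ?; lia.
Qed.

Definition mon s : 'X_{1..e - 2} := [multinom count_mem (var k) s | k < e - 2].

Lemma monE s k : mon s k = count_mem (var k) s.
Proof. by rewrite mnmE. Qed.

Lemma mon_cons k s : mon (var k :: s) = (U_(k) + mon s)%MM.
Proof.
by apply/mnmP => j; rewrite mnmDE !monE mnm1E /= (inj_eq var_inj).
Qed.

Lemma mon_sum (f : nat -> nat) s : all avail s ->
  \sum_k mon s k * f (var k) = \sum_(i <- s) f i.
Proof.
elim: s => [_|i s IHs /= /andP [/avail_var [k <-] /IHs eq_s]].
  by rewrite big_nil big1 // => k _; rewrite monE.
rewrite big_cons -eq_s mon_cons (bigD1 k) //= [in RHS](bigD1 k) //= addnA.
rewrite mnmDE mnm1E eqxx mulnDl mul1n; congr (_ + _)%N.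
apply: eq_bigr => j neq_jk; rewrite mnmDE mnm1E eq_sym (negbTE neq_jk).
by rewrite add0n.
Qed.

Lemma mdeg_mon s : all avail s -> mdeg (mon s) = size s.
Proof.
move=> s_av; rewrite mdegE -sum1_size -(mon_sum (fun=> 1) s_av).
by apply: eq_bigr => k _; rewrite muln1.
Qed.

Lemma mon_surj (a : 'X_{1..e - 2}) :
  exists s, [/\ all avail s, sorted leq s & a = mon s].
Proof.
pose s := flatten [seq nseq (a k) (var k : nat) | k <- enum 'I_(e - 2)].
have s_av : all avail s.
  apply/allP => i /flatten_mapP [k _ /nseqP [-> _]]; exact: var_avail.
exists (sort leq s); rewrite sort_sorted ?all_sort; last exact: leq_total.
split=> //; apply/mnmP => k; rewrite monE.
rewrite (permP (permEl (perm_sort _ _))) count_flatten -map_comp sumnE big_map.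
rewrite big_enum (bigD1 k) //= big1 ?addn0 => [|j neq_jk].
  by rewrite count_nseq /= eqxx mul1n.
by rewrite count_nseq /= (inj_eq var_inj) (negbTE neq_jk).
Qed.

End Encoding.

(** * The bidegree of a monomial and the toric ideal *)

Section Toric.

Variables (e m n : nat).
Hypotheses (hmn : m < n) (hn : n <= e - 2) (he : 1 < e).
Implicit Types (s t u : seq nat) (a b d : 'X_{1..(e - 2).+1}).

Local Notation avail := (avail e m n).
Local Notation gen := (@semigroup_gen e m n).

Definition bidegree a : nat * nat :=
  (\sum_k a k * (gen k).1, \sum_k a k * (gen k).2).

Lemma gen_widen (k : 'I_(e - 2)) :
  gen (widen_ord (leqnSn _) k) = (e + var_index m n k, e - 1 - var_index m n k).
Proof.
rewrite /semigroup_gen; have -> : widen_ord (leqnSn (e - 2)) k = lift ord_max k.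
  by apply/val_inj; rewrite /= /bump leqNgt ltn_ord.
by rewrite liftK.
Qed.

Lemma gen_max : gen ord_max = (0, 2 * e - 1).
Proof. by rewrite /semigroup_gen unlift_none. Qed.

Lemma gen_sum k : (gen k).1 + (gen k).2 = 2 * e - 1.
Proof.
have [i ->|->] := unliftP ord_max k; last by rewrite gen_max.
have -> : lift ord_max i = widen_ord (leqnSn _) i.
  by apply/val_inj; rewrite /= /bump leqNgt ltn_ord.
by rewrite gen_widen; have /and3P [] := var_avail hmn hn he i => /=; lia.
Qed.

Lemma bidegreeD a b : bidegree (a + b)%MM =
  ((bidegree a).1 + (bidegree b).1, (bidegree a).2 + (bidegree b).2).
Proof.
congr pair; rewrite -big_split; apply: eq_bigr => k _ /=;
by rewrite mnmDE mulnDl.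
Qed.

Lemma bidegree_mdeg a :
  (bidegree a).1 + (bidegree a).2 = mdeg a * (2 * e - 1).
Proof.
rewrite -big_split mdegE big_distrl; apply: eq_bigr => k _ /=.
by rewrite -mulnDr gen_sum.
Qed.

(** The last variable of the homogenized ring is y, so c is the exponent of y. *)
Definition hmon s c : 'X_{1..(e - 2).+1} :=
  (mnmwiden (mon e m n s) + U_(ord_max) *+ c)%MM.

Lemma hmon_max s c : hmon s c ord_max = c.
Proof. by rewrite mnmDE mnmwiden_ordmax mulmnE mnm1E eqxx mul1n. Qed.

Lemma hmon_widen s c (k : 'I_(e - 2)) :
  hmon s c (widen_ord (leqnSn _) k) = count_mem (var_index m n k) s.
Proof.
rewrite mnmDE mnmwiden_widen mulmnE mnm1E monE.
rewrite (negbTE (_ : ord_max != _)) ?addn0 //.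
by rewrite -(inj_eq val_inj) /= gtn_eqF.
Qed.

Lemma bidegree_hmon s c : all avail s -> bidegree (hmon s c) =
  (\sum_(i <- s) (e + i), \sum_(i <- s) (e - 1 - i) + c * (2 * e - 1)).
Proof.
move=> s_av; congr pair; rewrite big_ord_recr /= hmon_max gen_max ?muln0 ?addn0.
  rewrite -(mon_sum hmn hn he (addn e)) //; apply: eq_bigr => k _.
  by rewrite hmon_widen gen_widen monE.
rewrite -(mon_sum hmn hn he (fun i => e - 1 - i)) //; congr (_ + _)%N.
by apply: eq_bigr => k _; rewrite hmon_widen gen_widen monE.
Qed.

Lemma hmon_surj a : exists s c, [/\ all avail s, sorted leq s & a = hmon s c].
Proof.
pose a0 : 'X_{1..e - 2} := [multinom a (widen_ord (leqnSn _) k) | k < e - 2].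
have [s [s_av s_sorted a0_eq]] := mon_surj hmn hn he a0.
exists s, (a ord_max); split=> //; apply/mnmP => k.
have [i ->|->] := unliftP ord_max k; last by rewrite hmon_max.
have -> : lift ord_max i = widen_ord (leqnSn _) i.
  by apply/val_inj; rewrite /= /bump leqNgt ltn_ord.
by rewrite hmon_widen -monE -a0_eq mnmE.
Qed.

Lemma hmon_le s t c : (forall i, count_mem i t <= count_mem i s) ->
  (hmon t 0 <= hmon s c)%MM.
Proof.
move=> le_ts; apply/mnm_lepP => k.
have [i ->|->] := unliftP ord_max k; last by rewrite !hmon_max.
have -> : lift ord_max i = widen_ord (leqnSn _) i.
  by apply/val_inj; rewrite /= /bump leqNgt ltn_ord.
by rewrite !hmon_widen.
Qed.

Variable K : fieldType.
Implicit Types p : {mpoly K[(e - 2).+1]}.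

Local Open Scope ring_scope.

Definition mon2 (v : nat * nat) : 'X_{1..2} :=
  (U_(ord0) *+ v.1 + U_(ord_max) *+ v.2)%MM.

Lemma mon2_inj : injective mon2.
Proof.
move=> [v1 v2] [w1 w2] /mnmP eq_vw.
move: (eq_vw ord0) (eq_vw ord_max).
by rewrite !mnmDE !mulmnE !mnm1E /= !mul1n !mul0n !addn0 !add0n => -> ->.
Qed.

Lemma toric_mapX a : toric_map m n ('X_[a] : {mpoly K[_]}) = 'X_[mon2 (bidegree a)].
Proof.
rewrite /toric_map comp_mpolyX mpolyXD -!mpolyXn.
rewrite -!prodrXr -big_split /=; apply: eq_bigr => k _.
by rewrite tnth_mktuple exprMn -!exprM ![(a k * _)%N]mulnC.
Qed.

Lemma toric_mapE p : toric_map m n p =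
  \sum_(a <- msupp p) p@_a *: 'X_[mon2 (bidegree a)].
Proof.
rewrite /toric_map comp_mpolyEX; apply: eq_bigr => a _.
by rewrite -toric_mapX.
Qed.

(** The monomials of p with the bidegree of a have the same image, so a
    coefficient at a that is not zero has to be cancelled by another one. *)
Lemma toric_cancel p a : toric_ideal m n p -> a \in msupp p ->
  exists b, [/\ b \in msupp p, b != a & bidegree b = bidegree a].
Proof.
move=> p0 pa.
have [/hasP [b pb /andP [neq_ba /eqP]]|no_b] :=
  boolP (has (fun b => (b != a) && (bidegree b == bidegree a)) (msupp p)).
  by exists b.
move: (congr1 (mcoeff (mon2 (bidegree a))) p0); rewrite toric_mapE mcoeff0.
rewrite raddf_sum /= (bigD1_seq a) ?msupp_uniq //= mcoeffZ mcoeffX eqxx mulr1.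
rewrite big_seq_cond big1 ?addr0 => [p_a0|b /andP [pb neq_ba]].
  by move: pa; rewrite mcoeff_msupp p_a0 eqxx.
rewrite mcoeffZ mcoeffX (inj_eq mon2_inj).
case: eqP => [eq_ba|]; last by rewrite mulr0.
by case/negP: no_b; apply/hasP; exists b; rewrite // neq_ba eq_ba /=.
Qed.

Definition xprod s : {mpoly K[e - 2]} := \prod_(i <- s) xvar K e m n i.

Lemma xvar_var (k : 'I_(e - 2)) : xvar K e m n (var_index m n k) = 'X_k.
Proof.
rewrite /xvar; case: pickP => [j /eqP/var_inj -> //|/(_ k)].
by rewrite eqxx.
Qed.

Lemma xprodE s : all avail s -> xprod s = 'X_[mon e m n s].
Proof.
elim: s => [_|i s IHs /= /andP [/(avail_var hmn hn he) [k <-] /IHs s_eq]].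
  by rewrite /xprod big_nil (_ : mon _ _ _ _ = 0%MM) ?mpolyX0.
by rewrite /xprod big_cons -/(xprod s) s_eq xvar_var mon_cons mpolyXD.
Qed.

End Toric.

(** * Binomials of equal value and their leading monomials *)
(** The exponent of t_1 in the image of the product of the x_i for i in s. *)
Definition value (e : nat) (s : seq nat) : nat := sumn [seq e + i | i <- s].

(** A sufficient condition for the product over t to exceed the product over u
    in the graded reverse lexicographic order after homogenization: either u
    needs a power of y, the least variable, or u has an index above all of t. *)
Definition drops (t u : seq nat) : bool :=
  (size u < size t) ||
  ((size u == size t) && has (fun j => all (ltn^~ j) t) u).

Section Binomials.

Variables (e m n : nat) (K : fieldType).
Hypotheses (hmn : m < n) (hn : n <= e - 2) (he : 1 < e).
Implicit Types (s t u : seq nat) (g : {mpoly K[e - 2]}).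

Local Notation avail := (avail e m n).
Local Notation hmon := (hmon e m n).

(** The lists are recorded because they determine the leading monomial. *)
Definition is_binomial g t u : Prop :=
  [/\ all avail t, all avail u, value e t = value e u
    & g = (xprod e m n K t - xprod e m n K u)%R].

Lemma value_sum s : value e s = \sum_(i <- s) (e + i).
Proof. by rewrite /value sumnE big_map. Qed.

(** The two exponents of each generator of the semigroup sum to 2e - 1. *)
Lemma covalue_sum s : all avail s ->
  \sum_(i <- s) (e - 1 - i) + value e s = size s * (2 * e - 1).
Proof.
move=> s_av; rewrite value_sum -big_split -sum1_size big_distrl /=.
by apply: eq_big_seq => i /(allP s_av)/and3P [] /=; lia.
Qed.

Lemma bidegree_eq s t c d : all avail s -> all avail t ->
  value e s = value e t -> size s + c = size t + d ->
  bidegree m n (hmon s c) = bidegree m n (hmon t d).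
Proof.
move=> s_av t_av eq_v eq_c; rewrite !bidegree_hmon // -!value_sum eq_v.
have := covalue_sum s_av; have := covalue_sum t_av; rewrite -eq_v.
move=> covt covs; congr pair; apply: (@addIn (value e s)).
by rewrite addnAC covs [RHS]addnAC covt -!mulnDl eq_c.
Qed.

Lemma mdeg_hmon s c : all avail s -> mdeg (hmon s c) = size s + c.
Proof.
move=> s_av; rewrite mdegD mdegMn mdeg1 mul1n; congr (_ + _).
rewrite -(mdeg_mon hmn hn he s_av) !mdegE big_ord_recr /= mnmwiden_ordmax addn0.
by apply: eq_bigr => k _; rewrite mnmwiden_widen.
Qed.

Lemma homogenize_is_binomial g t u : is_binomial g t u ->
  size u <= size t -> mon e m n t != mon e m n u ->
  homogenize g = ('X_[hmon t 0] - 'X_[hmon u (size t - size u)])%R.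
Proof.
move=> [t_av u_av _ ->] le_ut neq_tu; rewrite !xprodE //.
by rewrite homogenize_binomial ?(mdeg_mon hmn hn he) // /hmon mulm0n addm0.
Qed.

Lemma is_binomialN g t u : is_binomial g t u -> is_binomial (- g)%R u t.
Proof. by case=> t_av u_av eq_v ->; split; rewrite // opprB. Qed.

Lemma is_binomial_toric g t u :
  is_binomial g t u -> toric_ideal m n (homogenize g).
Proof.
wlog le_ut : g t u / size u <= size t => [wlog_le gP|gP].
  case: (leqP (size u) (size t)) => [le_ut|/ltnW le_tu].
    exact: wlog_le le_ut gP.
  have := wlog_le _ _ _ le_tu (is_binomialN gP).
  rewrite homogenizeN /toric_ideal /toric_map raddfN => /(congr1 -%R)%R.
  by rewrite opprK oppr0.
case: (gP) => t_av u_av eq_v g_eq.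
case: (eqVneq (mon e m n t) (mon e m n u)) => [eq_tu|neq_tu].
  rewrite g_eq !xprodE // eq_tu subrr homogenize0.
  exact: raddf0.
rewrite (homogenize_is_binomial gP) // /toric_ideal /toric_map raddfB /=.
rewrite -!/(toric_map m n _) !toric_mapX; apply/eqP; rewrite subr_eq0.
rewrite (@bidegree_eq t u 0 (size t - size u)) //.
by rewrite addn0 subnKC.
Qed.

Lemma var_index_lt j k : j < k -> var_index m n j < var_index m n k.
Proof.
by rewrite /var_index /bump; lia.
Qed.

Lemma grevlex_drops t u : all avail t -> all avail u -> drops t u ->
  grevlex_lt (hmon u (size t - size u)) (hmon t 0).
Proof.
move=> t_av u_av drop_tu; apply/orP; right.
rewrite !mdeg_hmon // addn0 subnKC; last first.
  by case/orP: drop_tu => [/ltnW|/andP [/eqP -> _]].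
rewrite eqxx /=; apply/existsP; case/orP: drop_tu => [lt_ut|].
  exists ord_max; rewrite !hmon_max subn_gt0 lt_ut /=.
  by apply/forallP => k; rewrite ltnNge -ltnS ltn_ord.
case/andP => [/eqP -> /hasP [j ju lt_tj]].
(* The deciding variable is the one of the largest index in u: it does not
   divide the product over t, and no later variable divides either product. *)
pose j1 := foldr maxn 0 u.
have le_j1 i : i \in u -> i <= j1.
  rewrite /j1; elim: (u) => //= a v IHv; rewrite inE leq_max.
  by case/orP=> [/eqP ->|/IHv ->]; rewrite ?leqnn ?orbT.
have j1u : j1 \in u.
  rewrite /j1; case: (u) ju => // a v _; elim: v a => [|b v IHv] a.
    by rewrite /= maxn0 mem_head.
  rewrite /= in IHv *; rewrite {1}/maxn; case: ifP => _; last exact: mem_head.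
  by rewrite inE IHv orbT.
have lt_tj1 i : i \in t -> i < j1.
  by move=> /(allP lt_tj)/leq_trans; apply; apply: le_j1.
have [k k_eq] := avail_var hmn hn he (allP u_av _ j1u).
exists (widen_ord (leqnSn _) k); rewrite subnn !hmon_widen k_eq.
have -> : count_mem j1 t = 0.
  by apply/count_memPn/negP => /lt_tj1; rewrite ltnn.
rewrite -has_count has_pred1 j1u /=; apply/forallP => l; apply/implyP.
have [i ->|->] := unliftP ord_max l; last by rewrite !hmon_max.
have -> : lift ord_max i = widen_ord (leqnSn _) i.
  by apply/val_inj; rewrite /= /bump leqNgt ltn_ord.
move=> lt_ki; rewrite !hmon_widen.
have lt_i : j1 < var_index m n i by rewrite -k_eq; apply: var_index_lt.
have -> : count_mem (var_index m n i) t = 0.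
  by apply/count_memPn/negP => /lt_tj1; rewrite ltnNge ltnW.
have -> // : count_mem (var_index m n i) u = 0.
by apply/count_memPn/negP => /le_j1; rewrite leqNgt lt_i.
Qed.

(** Both signs occur among the minors, hence the two orders of t and u. *)
Lemma is_lead_binomial g t u : is_binomial g t u \/ is_binomial g u t ->
  drops t u ->
  is_lead_monomial (@grevlex_lt _) (homogenize g) (hmon t 0).
Proof.
wlog gP : g / is_binomial g t u => [wlog_g [gP|/is_binomialN gP]|_ drop_tu].
- by apply: wlog_g => //; left.
- move=> /(wlog_g _ gP (or_introl gP)); rewrite homogenizeN => -[lead_t le_t].
  split=> [|b bg]; first by rewrite -(perm_mem (msuppN _)).
  by apply: le_t; rewrite (perm_mem (msuppN _)).
case: (gP) => t_av u_av _ _.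
have lt_tu := grevlex_drops t_av u_av drop_tu.
have le_ut : size u <= size t.
  by case/orP: drop_tu => [/ltnW|/andP [/eqP -> _]].
have neq_tu : hmon t 0 != hmon u (size t - size u).
  by apply: contraTneq lt_tu => ->; rewrite grevlex_irr.
have neq_mon : mon e m n t != mon e m n u.
  move: lt_tu; apply: contraTneq => eq_mon.
  have eq_size : size t = size u.
    by rewrite -(mdeg_mon hmn hn he t_av) eq_mon (mdeg_mon hmn hn he u_av).
  by rewrite /hmon eq_mon eq_size subnn grevlex_irr.
rewrite (homogenize_is_binomial gP) //; split.
  by rewrite (perm_mem (msupp_binomial _ neq_tu)) mem_head.
move=> b; rewrite (perm_mem (msupp_binomial _ neq_tu)) !inE.
by case/orP => /eqP ->; rewrite ?eqxx.
Qed.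

End Binomials.

(** * Standard lists have distinct values modulo 2e - 1 *)

(** For i <= j and d > 0, the variable x_(j+d) is smaller than x_i and x_j, so
    x_i x_j exceeds x_(i-d) x_(j+d). A witness d satisfies j + d < e, so
    d <= e is no loss. *)
Definition widenable (e m n i j : nat) : bool :=
  has (fun d => [&& d <= i, avail e m n (i - d) & avail e m n (j + d)])
    (iota 1 e).

(** Representatives of the residues modulo 2e - 1 that no pair of indices has as
    its sum; [exceptional_residue] lists these residues. They exist only if m or
    n is close to an end of the range of indices. *)
Definition exceptional (e m n i j k : nat) : bool :=
  (i == 0) &&
  [|| [&& n == e - 2, j == 0 & k == e - 3],
      [&& n == e - 2, m == 1, j == 3 & k == e - 3],
      [&& n == e - 2, m == e - 4, j == 0 & k == e - 5],
      [&& n == e - 2, m == e - 3, j <= 1 & k == e - 4],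
      [&& m == 1, j == 2 & k == e - 2],
      [&& m == 1, n == 2, j == 3 & (k == e - 3) || (k == e - 2)],
      [&& m == 1, n == 3, j == 4 & k == e - 2]
    | [&& m == 2, n == 3, j == 4 & k == e - 2]].

Definition standard (e m n : nat) (s : seq nat) : bool :=
  match s with
  | [::] | [:: _] => true
  | [:: i; j] => ~~ widenable e m n i j
  | [:: i; j; k] => exceptional e m n i j k
  | _ => false
  end.

(** Proving the disjuncts one at a time keeps every linear arithmetic problem
    small. *)
Ltac some_disjunct tac :=
  match goal with
  | |- _ /\ _ => split; [solve [tac] | some_disjunct tac]
  | |- _ \/ _ => first [left; some_disjunct tac | right; some_disjunct tac]
  | _ => solve [tac]
  end.

Ltac split_hyps :=
  repeat match goal with
  | H : _ /\ _ |- _ => destruct H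
  | H : _ \/ _ |- _ => destruct H
  end.

Section Standard.

Variables (e m n : nat).
Hypotheses (he : 10 <= e) (hm : 1 <= m) (hmn : m < n) (hn : n <= e - 2).
Implicit Types (s t u : seq nat).

Local Notation avail := (avail e m n).
Local Notation widenable := (widenable e m n).
Local Notation exceptional := (exceptional e m n).
Local Notation standard := (standard e m n).

Lemma widenableP i j : reflect
  (exists d, [/\ 0 < d, d <= i, avail (i - d) & avail (j + d)])
  (widenable i j).
Proof.
apply: (iffP hasP) => [[d] | [d [d_gt0 le_di i_av j_av]]].
  by rewrite mem_iota => /andP [d_gt0 _] /and3P []; exists d.
exists d; last by apply/and3P.
by rewrite mem_iota d_gt0 /=; move: j_av => /and3P []; lia.
Qed.

(** If the least admissible d were larger than 3, then each of d' = 1, 2, 3 would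
    make i - d' or j + d' equal to m or n. But each of m and n does so for
    at most one d' on each side and, since i <= j, not on both sides. *)
Lemma widenable_small i j : avail i -> avail j -> i <= j -> widenable i j ->
  exists d, [/\ 0 < d <= 3, d <= i, avail (i - d), avail (j + d)
    & forall d', 0 < d' -> d' < d -> ~~ (avail (i - d') && avail (j + d'))].
Proof.
move=> i_av j_av le_ij /hasP [d0 d0_iota d0P].
have /ex_minnP [d dP d_min] : exists d,
    [&& 0 < d, d <= i, avail (i - d) & avail (j + d)].
  by exists d0; move: d0_iota d0P; rewrite mem_iota => /andP [-> _].
case/and4P: dP => d_gt0 le_di id_av jd_av; exists d.
have d_min' d' : 0 < d' -> d' < d -> ~~ (avail (i - d') && avail (j + d')).
  move=> d'_gt0 lt_d'd; apply/negP => d'_av; have := d_min d'.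
  by rewrite d'_gt0 (ltnW (leq_trans lt_d'd le_di)) d'_av => /(_ isT); lia.
split=> //; rewrite d_gt0 leqNgt; apply/negP => d_gt3.
have blocked d' : 0 < d' -> d' < d ->
    i = m + d' \/ i = n + d' \/ j + d' = m \/ j + d' = n.
  move=> d'_gt0 lt_d'd; have := d_min' d' d'_gt0 lt_d'd.
  have /and3P [lt_i _ _] := i_av; have /and3P [lt_j _ _] := jd_av.
  clear - lt_i lt_j lt_d'd le_di; rewrite /avail; lia.
clear - le_ij le_di d_gt3 hmn blocked.
have [|[|[|]]] := blocked 1 isT (ltn_trans (isT : 1 < 3) d_gt3);
have [|[|[|]]] := blocked 2 isT (ltn_trans (isT : 2 < 3) d_gt3);
have [|[|[|]]] := blocked 3 isT d_gt3; clear blocked; lia.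
Qed.

Lemma exceptionalE i j k : exceptional i j k -> i = 0 /\
  ((n = e - 2 /\ j = 0 /\ k = e - 3) \/
   (n = e - 2 /\ m = 1 /\ j = 3 /\ k = e - 3) \/
   (n = e - 2 /\ m = e - 4 /\ j = 0 /\ k = e - 5) \/
   (n = e - 2 /\ m = e - 3 /\ j = 0 /\ k = e - 4) \/
   (n = e - 2 /\ m = e - 3 /\ j = 1 /\ k = e - 4) \/
   (m = 1 /\ j = 2 /\ k = e - 2) \/
   (m = 1 /\ n = 2 /\ j = 3 /\ k = e - 3) \/
   (m = 1 /\ n = 2 /\ j = 3 /\ k = e - 2) \/
   (m = 1 /\ n = 3 /\ j = 4 /\ k = e - 2) \/
   (m = 2 /\ n = 3 /\ j = 4 /\ k = e - 2)).
Proof.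
move=> /andP [/eqP -> H]; split=> //; move: H; clear.
case/orP=> [/and3P [/eqP-> /eqP-> /eqP->]|]; first by tauto.
case/orP=> [/and4P [/eqP-> /eqP-> /eqP-> /eqP->]|]; first by tauto.
case/orP=> [/and4P [/eqP-> /eqP-> /eqP-> /eqP->]|]; first by tauto.
case/orP=> [/and4P [/eqP-> /eqP-> j_le1 /eqP->]|].
  have [->|->] : j = 0 \/ j = 1; first by clear - j_le1; lia.
    by tauto.
  by tauto.
case/orP=> [/and3P [/eqP-> /eqP-> /eqP->]|]; first by tauto.
case/orP=> [/and4P [/eqP-> /eqP-> /eqP-> /orP [/eqP->|/eqP->]]|]; try tauto.
case/orP=> [/and4P [/eqP-> /eqP-> /eqP-> /eqP->]|]; first by tauto.
by case/and4P=> /eqP-> /eqP-> /eqP-> /eqP->; tauto.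
Qed.

(** The least natural number congruent to the value minus 2e: the sum of the two
    indices, once lists of size below two are padded with e - 1, an index whose
    variable has value 2e - 1. For triples, only those whose first index is 0
    matter. *)
Definition residue s : nat :=
  match s with
  | [::] => 2 * e - 2
  | [:: i] => e - 1 + i
  | [:: i; j] => i + j
  | [:: _; j; k] => if e + j + k < 2 * e - 1 then e + j + k
                    else e + j + k - (2 * e - 1)
  | _ => 0
  end.

Lemma residueP s : standard s -> all avail s ->
  residue s < 2 * e - 1 /\ value e s = 2 * e + residue s %[mod 2 * e - 1].
Proof.
have modE a b c : a = b + c * (2 * e - 1) -> a = b %[mod 2 * e - 1].
  by move=> ->; rewrite addnC modnMDl.
have modE' a b c : b = a + c * (2 * e - 1) -> a = b %[mod 2 * e - 1].
  by move=> /modE ->.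
case: s => [|i [|j [|k [|l s]]]] //=; rewrite /value /= ?addn0 /avail.
- by move=> *; split; [lia|apply: (modE' _ _ 2); lia].
- by move=> *; split; [lia|apply: (modE' _ _ 1); lia].
- by move=> *; split; [lia|congr (_ %% _); lia].
- case/exceptionalE => -> exc /and4P [_ j_av k_av _].
  case: ifP => lt_P; split; try by clear - exc lt_P he; lia.
    by congr (_ %% _); lia.
  by apply: (modE _ _ 1); clear - lt_P; lia.
Qed.

Lemma widenable_sum i j i' j' : avail i -> avail j ->
  i + j = i' + j' -> i < i' -> widenable i' j'.
Proof.
move=> i_av j_av eq_ij lt_ii'; apply/widenableP; exists (i' - i).
have -> : i' - (i' - i) = i by lia.
have -> : j' + (i' - i) = j by lia.
by split=> //; lia.
Qed.

(** Of two pairs with the same sum, the one with the larger first index can be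
    widened to the other. *)
Lemma nonwidenable_sum i j i' j' :
  avail i -> avail j -> avail i' -> avail j' ->
  ~~ widenable i j -> ~~ widenable i' j' -> i + j = i' + j' -> i = i'.
Proof.
move=> i_av j_av i'_av j'_av /negP wij /negP wij' eq_ij.
have [lt_ii'|lt_i'i|//] := ltngtP i i'.
  by case: wij'; apply: (widenable_sum i_av j_av).
by case: wij; apply: (widenable_sum i'_av j'_av).
Qed.

Lemma exceptional_residue j k r : avail j -> avail k -> exceptional 0 j k ->
  r = residue [:: 0; j; k] ->
  (n = e - 2 /\ m <> e - 3 /\ r = 2 * e - 3 /\ j = 0 /\ k = e - 3) \/
  (n = e - 2 /\ m = e - 3 /\ r = 2 * e - 3 /\ j = 1 /\ k = e - 4) \/
  (n = e - 2 /\ m = e - 3 /\ r = 2 * e - 4 /\ j = 0 /\ k = e - 4) \/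
  (n = e - 2 /\ m = e - 4 /\ r = 2 * e - 5 /\ j = 0 /\ k = e - 5) \/
  (n = e - 2 /\ m = 1 /\ r = 1 /\ j = 3 /\ k = e - 3) \/
  (n <> e - 2 /\ n <> 2 /\ m = 1 /\ r = 1 /\ j = 2 /\ k = e - 2) \/
  (n = 2 /\ m = 1 /\ r = 1 /\ j = 3 /\ k = e - 3) \/
  (n = 2 /\ m = 1 /\ r = 2 /\ j = 3 /\ k = e - 2) \/
  (n = 3 /\ m <= 2 /\ r = 3 /\ j = 4 /\ k = e - 2).
Proof.
move=> /and3P [_ /eqP jm /eqP jn] /and3P [_ /eqP km /eqP kn].
move=> /exceptionalE [_ H] -> /=; case: ifP => Hlt;
move: H => [|[|[|[|[|[|[|[|[|]]]]]]]]] [-> ?]; try by exfalso; lia.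
all: repeat match goal with
     | |- _ \/ _ => first [left; by do 4?[split; first by lia]; lia | right]
     | _ => by do 4?[split; first by lia]; lia
     end.
Qed.

(** The exceptional triples supplement the pairs: the sums of two indices avoid
    their residues. *)
Lemma exceptional_sum j k p q : avail j -> avail k -> exceptional 0 j k ->
  avail p -> avail q -> p <= q -> p + q != residue [:: 0; j; k].
Proof.
move=> j_av k_av exc.
move=> /and3P [pe /eqP pm /eqP pn] /and3P [qe /eqP qm /eqP qn] le_pq.
apply/eqP => /(exceptional_residue j_av k_av exc).
clear - pe qe pm pn qm qn le_pq he hm.
move=> [|[|[|[|[|[|[|[|]]]]]]]]; lia.
Qed.

Lemma exceptional_inj j k p q : avail j -> avail k -> avail p -> avail q ->
  exceptional 0 j k -> exceptional 0 p q ->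
  residue [:: 0; j; k] = residue [:: 0; p; q] -> j = p /\ k = q.
Proof.
move=> j_av k_av p_av q_av excj excp eq_r.
have := exceptional_residue j_av k_av excj erefl.
have := exceptional_residue p_av q_av excp eq_r.
move: (residue _) => r; clear - he.
move=> [|[|[|[|[|[|[|[|]]]]]]]] ?; move=> [|[|[|[|[|[|[|[|]]]]]]]]; lia.
Qed.

(** A list of size below two gets padded with e - 1 to a pair; as its own entries
    are below e - 1, a pair with the same sum and both entries below e - 1 could
    be widened to it. *)
Lemma standard_inj s t : standard s -> standard t -> all avail s -> all avail t ->
  sorted leq s -> sorted leq t ->
  all (ltn^~ (e - 1)) s -> all (ltn^~ (e - 1)) t ->
  residue s = residue t -> s = t.
Proof.
have e_av : avail (e - 1) by apply/and3P; split; lia.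
wlog le_st : s t / size s <= size t => [wlog_le|].
  case: (leqP (size s) (size t)) => [|/ltnW] le_st *; first exact: wlog_le.
  by symmetry; apply: wlog_le.
have nz a b : exceptional a b.1 b.2 -> a = 0 by case/exceptionalE.
case: t le_st => [|p [|q [|r [|? t]]]] //; case: s => [|i [|j [|k [|? s]]]] //= _.
- by move=> _ _ _ _ _ _ _ /andP [lt_p _] eq_r; exfalso; lia.
- by move=> _ _ _ _ _ _ _ _ /addnI ->.
- by move=> _ _ _ _ _ _ _ /and3P [lt_p lt_q _] eq_r; exfalso; lia.
- move=> _ /negP wpq /andP [i_av _] /and3P [p_av q_av _] _ /andP [le_pq _].
  move=> /andP [lt_i _] /and3P [lt_p lt_q _] eq_r; case: wpq.
  by apply: (@widenable_sum i (e - 1)); rewrite // ?[i + _]addnC //; lia.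
- move=> wij wpq /and3P [i_av j_av _] /and3P [p_av q_av _] _ _ _ _ eq_r.
  have eq_ip := nonwidenable_sum i_av j_av p_av q_av wij wpq eq_r.
  by rewrite eq_ip; move: eq_r; rewrite eq_ip => /addnI ->.
- move=> _ exc _ /and4P [p_av q_av r_av _] _ _ _ _ eq_r; exfalso.
  have p0 := nz _ (q, r) exc; rewrite p0 in exc.
  have /eqP [] := exceptional_sum q_av r_av exc e_av e_av (leqnn _).
  by rewrite /= -eq_r; lia.
- move=> _ exc /andP [i_av _] /and4P [p_av q_av r_av _] _ _ /andP [lt_i _] _ eq_r.
  exfalso; have p0 := nz _ (q, r) exc; rewrite p0 in exc.
  have /eqP [] := exceptional_sum q_av r_av exc i_av e_av (ltnW lt_i).
  by rewrite /= -eq_r addnC.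
- move=> _ exc /and3P [i_av j_av _] /and4P [p_av q_av r_av _] /andP [le_ij _].
  move=> _ _ _ eq_r; exfalso; have p0 := nz _ (q, r) exc; rewrite p0 in exc.
  by have /eqP [] := exceptional_sum q_av r_av exc i_av j_av le_ij.
- move=> exc' exc /and4P [i_av j_av k_av _] /and4P [p_av q_av r_av _] _ _ _ _.
  move=> eq_r; have p0 := nz _ (q, r) exc; have i0 := nz _ (j, k) exc'.
  rewrite p0 i0 in exc exc' *.
  by have [-> ->] := exceptional_inj j_av k_av q_av r_av exc' exc eq_r.
Qed.

Lemma standard_value_inj s t :
  standard s -> standard t -> all avail s -> all avail t ->
  sorted leq s -> sorted leq t ->
  all (ltn^~ (e - 1)) s -> all (ltn^~ (e - 1)) t ->
  value e s = value e t %[mod 2 * e - 1] -> s = t.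
Proof.
move=> s_std t_std s_av t_av s_sort t_sort s_lt t_lt.
have [s_lt_r ->] := residueP s_std s_av; have [t_lt_r ->] := residueP t_std t_av.
move/eqP; rewrite eqn_modDl !modn_small // => /eqP.
exact: standard_inj.
Qed.

Lemma nonwidenable_blocked d i j : i < e -> j < e -> ~~ widenable i j -> 0 < d ->
  i < d \/ e <= j + d \/ i = m + d \/ i = n + d \/ j + d = m \/ j + d = n.
Proof.
move=> lt_i lt_j wij d_gt0.
have : ~~ [&& d <= i, avail (i - d) & avail (j + d)].
  apply: contra wij => /and3P [? ? ?]; apply/widenableP; exists d; split=> //.
rewrite /avail; clear - lt_i; lia.
Qed.

Definition pair_shape i j :=
  i = 0 \/ (i = 1 /\ (j + 1 = m \/ j + 1 = n)) \/
  (i = 2 /\ m = 1 /\ (j + 2 = n \/ j = e - 2)) \/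
  (i = 2 /\ n = m + 1 /\ j + 1 = m) \/
  (j = e - 2 /\ (i = m + 1 \/ i = n + 1)) \/
  (j = e - 3 /\ i = m + 2 /\ (n = m + 1 \/ n = e - 2)).

(** Each of d = 1, 2, 3 has to be blocked: by an end of the range of indices, or by
    m or n. *)
Lemma pair_shapeP i j : avail i -> avail j -> i <= j -> j < e - 1 ->
  ~~ widenable i j -> pair_shape i j.
Proof.
move=> i_av j_av le_ij lt_j wij.
have [lt_ie /eqP im /eqP iN] := and3P i_av.
have [lt_je /eqP jm /eqP jn] := and3P j_av.
have B1 := nonwidenable_blocked lt_ie lt_je wij (isT : 0 < 1).
have B2 := nonwidenable_blocked lt_ie lt_je wij (isT : 0 < 2).
have B3 := nonwidenable_blocked lt_ie lt_je wij (isT : 0 < 3).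
clear - he hm hmn hn le_ij lt_j im iN jm jn B1 B2 B3; rewrite /pair_shape.
case: B1 => [?|]; first by left; lia.
case=> [?|B1]; first by exfalso; lia.
case: B1 => [?|[?|[?|?]]].
all: case: B2 => [?|[?|[?|[?|[?|?]]]]]; try by (exfalso; clear B3; lia).
all: try by clear B3; some_disjunct lia.
all: case: B3 => [?|[?|[?|[?|[?|?]]]]]; first [by exfalso; lia | some_disjunct lia].
Qed.

End Standard.

(** * Triples without a widenable pair *)
Section TripleShapes.

Variables (e m n : nat).
Hypotheses (he : 10 <= e) (hm : 1 <= m) (hmn : m < n) (hn : n <= e - 2).
Hypothesis (hne : (m, n) <> (e - 4, e - 3)).

Local Notation avail := (avail e m n).
Local Notation widenable := (widenable e m n).

Definition triple_shape i j k :=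
  (i = 0 /\ j = 0) \/
  (i = 0 /\ j = 1 /\ (k + 1 = m \/ k + 1 = n)) \/
  (i = 0 /\ j = 2 /\ m = 1 /\ k + 2 = n) \/
  (i = 0 /\ j = 2 /\ n = m + 1 /\ k + 1 = m) \/
  (i = 0 /\ k = e - 2 /\ (j = m + 1 \/ j = n + 1)) \/
  (i = 0 /\ k = e - 3 /\ j = m + 2 /\ (n = m + 1 \/ n = e - 2)) \/
  (i = 1 /\ j = 1 /\ m = 2 /\ (k = 1 \/ k + 1 = n)) \/
  ((i = 1 \/ i = 2) /\ j = 2 /\ k = 2 /\ m = 3 /\ n = 4) \/
  (i = 2 /\ j = 2 /\ m = 1 /\ n = 4 /\ (k = 2 \/ k = e - 2)) \/
  ((i = m + 1 \/ i = e - 2) /\ j = e - 2 /\ k = e - 2 /\ n = e - 3) \/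
  (i = e - 3 /\ j = e - 3 /\ k = e - 3 /\ m = e - 5 /\ (n = e - 4 \/ n = e - 2)) \/
  (i = e - 3 /\ j = e - 3 /\ k = e - 2 /\ m = e - 5 /\ n = e - 4) \/
  (i = 1 /\ j = e - 3 /\ k = e - 3 /\ m = e - 5 /\ n = e - 2).

Lemma triple_shapeP i j k : avail i -> avail j -> avail k ->
  i <= j -> j <= k -> k < e - 1 ->
  ~~ widenable i j -> ~~ widenable i k -> ~~ widenable j k ->
  triple_shape i j k.
Proof.
move=> i_av j_av k_av le_ij le_jk lt_k wij wik wjk.
have Pij := pair_shapeP he hm hmn hn i_av j_av le_ij (leq_ltn_trans le_jk lt_k) wij.
have Pik := pair_shapeP he hm hmn hn i_av k_av (leq_trans le_ij le_jk) lt_k wik.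
have Pjk := pair_shapeP he hm hmn hn j_av k_av le_jk lt_k wjk.
have [_ /eqP im /eqP iN] := and3P i_av.
have [_ /eqP jm /eqP jn] := and3P j_av.
have [_ /eqP km /eqP kn] := and3P k_av.
have hne' : ~ (m = e - 4 /\ n = e - 3).
  by move=> [em en]; apply: hne; rewrite em en.
clear - he hm hmn hn hne' le_ij le_jk lt_k im iN jm jn km kn Pij Pik Pjk.
rewrite /pair_shape /triple_shape in Pij Pik Pjk *.
case: Pij => [?|Pij].
  clear Pik im iN jm jn km kn hne'.
  by case: Pjk => [?|[?|[?|[?|[?|?]]]]]; split_hyps; some_disjunct lia.
case: Pij => [?|[?|[?|[?|?]]]].
all: case: Pik => [?|[?|[?|[?|[?|?]]]]]; try by (exfalso; clear Pjk; lia).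
all: case: Pjk => [?|[?|[?|[?|[?|?]]]]]; try by (exfalso; lia).
all: split_hyps; try by (exfalso; lia).
all: clear im iN jm jn km kn hne'; some_disjunct lia.
Qed.

End TripleShapes.

(** * Membership in lists of polynomials and of minors *)
Section Membership.

Variable T : eqType.
Implicit Types (P : T -> Prop) (L : seq T).

(** [all_in] and [some_in] have rules for each way in which the lists of
    polynomials are built, so that proofs about an explicit list follow its
    structure. *)
Definition all_in P L := forall g, g \in L -> P g.

Lemma all_in_cat P L1 L2 : all_in P L1 -> all_in P L2 -> all_in P (L1 ++ L2).
Proof. by move=> P1 P2 g; rewrite mem_cat => /orP [/P1|/P2]. Qed.

Lemma all_in_nil P : all_in P [::].
Proof. by []. Qed.

Lemma all_in_cons P g L : P g -> all_in P L -> all_in P (g :: L).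
Proof. by move=> Pg PL h /[!inE] /orP [/eqP ->|/PL]. Qed.

Lemma all_in_map P (F : nat -> T) a b :
  (forall j, a <= j -> j <= b -> P (F j)) ->
  all_in P [seq F j | j <- closed_range a b].
Proof.
move=> PF g /mapP [j]; rewrite mem_index_iota ltnS => /andP [le_aj le_jb] ->.
exact: PF.
Qed.

Lemma all_in_map_filter P (F : nat -> T) (Q : pred nat) a b :
  (forall j, a <= j -> j <= b -> Q j -> P (F j)) ->
  all_in P [seq F j | j <- closed_range a b & Q j].
Proof.
move=> PF g /mapP [j]; rewrite mem_filter mem_index_iota ltnS.
by case/and3P=> Qj le_aj le_jb ->; apply: PF.
Qed.

Definition some_in P L := exists2 g, g \in L & P g.

Lemma some_in_catl P L1 L2 : some_in P L1 -> some_in P (L1 ++ L2).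
Proof. by case=> g gL Pg; exists g; rewrite // mem_cat gL. Qed.

Lemma some_in_catr P L1 L2 : some_in P L2 -> some_in P (L1 ++ L2).
Proof. by case=> g gL Pg; exists g; rewrite // mem_cat gL orbT. Qed.

Lemma some_in_head P g L : P g -> some_in P (g :: L).
Proof. by exists g; rewrite ?mem_head. Qed.

Lemma some_in_behead P g L : some_in P L -> some_in P (g :: L).
Proof. by case=> h hL Ph; exists h; rewrite // inE hL orbT. Qed.

Lemma some_in_map P (F : nat -> T) a b j :
  a <= j -> j <= b -> P (F j) -> some_in P [seq F j | j <- closed_range a b].
Proof.
move=> le_aj le_jb PF; exists (F j) => //; apply/mapP; exists j => //.
by rewrite mem_index_iota le_aj ltnS.
Qed.

Lemma some_in_map_filter P (F : nat -> T) (Q : pred nat) a b j :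
  a <= j -> j <= b -> Q j -> P (F j) ->
  some_in P [seq F j | j <- closed_range a b & Q j].
Proof.
move=> le_aj le_jb Qj PF; exists (F j) => //; apply/mapP; exists j => //.
by rewrite mem_filter Qj mem_index_iota le_aj ltnS.
Qed.

End Membership.

Section Minors.

Variable A : pzRingType.
Implicit Types (c d : A * A) (L : seq (A * A)).

(** For such columns, and not the other way round, det2 c d is among the minors. *)
Definition in_order c d L :=
  exists L1 L2, [/\ L = L1 ++ L2, c \in L1 & d \in L2].

Lemma in_order_cross c d L1 L2 : c \in L1 -> d \in L2 -> in_order c d (L1 ++ L2).
Proof. by exists L1, L2. Qed.

Lemma in_order_catl c d L1 L2 : in_order c d L1 -> in_order c d (L1 ++ L2).
Proof.
case=> [M1 [M2 [-> cM dM]]]; exists M1, (M2 ++ L2).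
by rewrite catA mem_cat dM.
Qed.

Lemma in_order_catr c d L1 L2 : in_order c d L2 -> in_order c d (L1 ++ L2).
Proof.
case=> [M1 [M2 [-> cM dM]]]; exists (L1 ++ M1), M2.
by rewrite catA mem_cat cM orbT.
Qed.

Lemma det2_in_minors2 c d L : in_order c d L -> det2 c d \in minors2 L.
Proof.
case=> [L1 [L2 [-> ]]]; elim: L1 => [|b L1 IH] //=; rewrite inE mem_cat.
case/orP => [/eqP <- d2|cL1 /(IH cL1) ->]; last by rewrite orbT.
by rewrite map_f // mem_cat d2 orbT.
Qed.

Lemma minors2_all_in (P : A -> Prop) (C : A * A -> Prop) L :
  (forall c d, C c -> C d -> P (det2 c d)) -> all_in C L -> all_in P (minors2 L).
Proof.
move=> PC; elim: L => [|c L IH] //= CL; apply: all_in_cat; last first.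
  by apply: IH => d dL; apply: CL; rewrite inE dL orbT.
move=> g /mapP [d dL ->]; apply: PC; apply: CL; first exact: mem_head.
by rewrite inE dL orbT.
Qed.

Lemma minors2_first_col_all_in (P : A -> Prop) (C : A * A -> Prop) L :
  (forall c d, C c -> C d -> P (det2 c d)) -> all_in C L ->
  all_in P (minors2_first_col L).
Proof.
case: L => [|c L] //= PC CL g /mapP [d dL ->].
by apply: PC; apply: CL; rewrite ?mem_head // inE dL orbT.
Qed.

End Minors.

(** * Every element of the basis is a binomial of the toric ideal *)
Section Binomiality.

Variables (e m n : nat) (K : fieldType).
Implicit Types (s t u : seq nat) (g : {mpoly K[e - 2]}).

Local Notation avail := (avail e m n).
Local Notation x := (xvar K e m n).

Lemma xprod_var i : x i = xprod e m n K [:: i].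
Proof. by rewrite /xprod big_seq1. Qed.

Lemma xprod_cat s t : (xprod e m n K s * xprod e m n K t)%R = xprod e m n K (s ++ t).
Proof. by rewrite /xprod big_cat. Qed.

Lemma xprod_sq s : (xprod e m n K s ^+ 2)%R = xprod e m n K (s ++ s).
Proof. by rewrite -xprod_cat. Qed.

Lemma xprod_cube s : (xprod e m n K s ^+ 3)%R = xprod e m n K (s ++ s ++ s).
Proof. by rewrite -!xprod_cat. Qed.

Definition balanced g := exists t u, is_binomial m n g t u.

Lemma xprod_binomial t u : all avail t -> all avail u ->
  value e t = value e u -> balanced (xprod e m n K t - xprod e m n K u)%R.
Proof. by move=> t_av u_av eq_v; exists t, u. Qed.

(** In each of the matrices A and B all columns are steps for the same d, and this
    makes the two products in a minor have the same value. The last columns fit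
    in since the value 2e of x_0^2 is what an index e would contribute. *)
Definition is_step d (c : {mpoly K[e - 2]} * {mpoly K[e - 2]}) :=
  exists s t, [/\ c = (xprod e m n K s, xprod e m n K t), all avail s, all avail t
                & value e t = value e s + d].

Lemma value_cat s t : value e (s ++ t) = value e s + value e t.
Proof. by rewrite /value map_cat sumn_cat. Qed.

Lemma det2_binomial d c c' : is_step d c -> is_step d c' ->
  balanced (det2 c c').
Proof.
case=> s [t [-> s_av t_av eq_st]] [s' [t' [-> s'_av t'_av eq_st']]].
rewrite /det2 /= !xprod_cat; apply: xprod_binomial.
- by rewrite all_cat s_av.
- by rewrite all_cat s'_av.
by rewrite !value_cat eq_st eq_st'; lia.
Qed.

End Binomiality.

Arguments balanced e m n {K} g.
Arguments is_step e m n {K} d c.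

(** Disequalities are expensive case splits for linear arithmetic and are mostly
    irrelevant, so they are tried last; the same reason lies behind [show_neq],
    which proves a disequality by deriving a given one from its negation. *)
Ltac lia_eq := repeat match goal with H : ~ _ |- _ => clear H end; lia.

Ltac lia_any := first [lia_eq | lia].

Ltac show_neq :=
  let E := fresh "E" in
  apply/eqP => E;
  first [ by exfalso; lia_eq
        | match goal with NE : _ <> _ |- _ => by apply NE; lia_eq end ].

Ltac show_avail := apply/and3P; split; [lia_any | show_neq | show_neq].

Ltac show_conj :=
  lazymatch goal with
  | |- is_true (_ && _) => apply/andP; split; show_conj
  | |- is_true (avail _ _ _ _) => show_avail
  | |- is_true (_ != _) => show_neq
  | |- is_true true => done
  | |- _ => lia_any
  end.

Ltac show_avails := rewrite /=; show_conj.

Ltac show_filter := rewrite /= ?inE ?negb_or; show_conj.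

Ltac collect_vars :=
  rewrite !xprod_var ?xprod_sq ?xprod_cube ?xprod_cat /=.

Ltac show_binomial :=
  collect_vars; apply: xprod_binomial;
  [show_avails | show_avails | rewrite /value /=; lia_eq].

Ltac intro_neqs :=
  lazymatch goal with
  | |- is_true (_ && _) -> _ => case/andP; intro_neqs
  | |- is_true (_ != _) -> _ => move/eqP => ?; intro_neqs
  | |- _ => idtac
  end.

Ltac split_cond C :=
  lazymatch type of C with
  | is_true (_ && _) =>
      let C1 := fresh "C" in let C2 := fresh "C" in
      case/andP: C => C1 C2; split_cond C1; split_cond C2
  | is_true (_ == _) => move/eqP: C => C
  | _ => idtac
  end.

(** In a nested conditional, the negated conditions of the earlier cases are
    dropped on entering a case: each case is described completely by its own
    condition. *)
Ltac enter_case C :=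
  repeat match goal with N : _ = false |- _ => clear N end; split_cond C.

Ltac show_all_in tac :=
  lazymatch goal with
  | |- all_in _ (if _ then _ else _) =>
      let C := fresh "C" in
      case: ifP => C; [enter_case C; show_all_in tac | show_all_in tac]
  | |- all_in _ (_ ++ _) => apply: all_in_cat; show_all_in tac
  | |- all_in _ (_ :: _) => apply: all_in_cons; [tac | show_all_in tac]
  | |- all_in _ [::] => exact: all_in_nil
  | |- all_in _ (map _ (filter _ _)) =>
      apply: all_in_map_filter => /= ? ? ?; rewrite ?inE ?negb_or; intro_neqs; tac
  | |- all_in _ (map _ _) => apply: all_in_map => /= ? ? ?; tac
  end.

Section Steps.

Variables (e m n : nat) (K : fieldType).

Local Notation avail := (avail e m n).
Local Notation x := (xvar K e m n).

Lemma is_step_var d i j :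
  avail i -> avail j -> j = i + d -> is_step e m n d (x i, x j).
Proof.
move=> i_av j_av ijE; exists [:: i], [:: j].
by rewrite -!xprod_var /= i_av j_av; split; rewrite // /value /=; lia.
Qed.

Lemma is_step_top d i :
  avail 0 -> avail i -> i + d = e -> is_step e m n d (x i, x 0 ^+ 2)%R.
Proof.
move=> av0 i_av id_eq; exists [:: i], [:: 0; 0].
rewrite !xprod_var xprod_sq /= av0 i_av.
by split; rewrite // /value /=; lia.
Qed.

End Steps.

Ltac show_step :=
  first [ apply: is_step_var; [show_avail | show_avail | lia]
        | apply: is_step_top; [show_avail | show_avail | lia] ].

Section AllBinomials.

Variables (e m n : nat) (K : fieldType).
Hypotheses (he : 10 <= e) (hm : 1 <= m) (hmn : m < n) (hn : n <= e - 2).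

Lemma matA1_step : m = 1 -> all_in (is_step e m n 1) (matA1 K e m n).
Proof. by move=> m1; rewrite /matA1 /step_cols; show_all_in show_step. Qed.

Lemma matA2_step : 2 <= m -> all_in (is_step e m n 1) (matA2 K e m n).
Proof. by move=> m2; rewrite /matA2 /step_cols; show_all_in show_step. Qed.

Lemma matB_step : m = 1 ->
  all_in (is_step e m n (if n == 2 then 3 else 2)) (matB K e m n).
Proof.
move=> m1; rewrite /matB /step_cols; case: eqP => n2.
  by show_all_in show_step.
by case: eqP => n_top /=; show_all_in show_step.
Qed.

Lemma setL_binomial : m = 1 -> all_in (balanced e m n) (setL K e m n).
Proof. by move=> m1; rewrite /setL; show_all_in show_binomial. Qed.

Lemma setK_binomial : 2 <= m -> all_in (balanced e m n) (setK K e m n).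
Proof. by move=> m2; rewrite /setK; show_all_in show_binomial. Qed.

Lemma setG'_binomial : all_in (balanced e m n) (setG' K e m n).
Proof. by rewrite /setG' !inE; show_all_in show_binomial. Qed.

Lemma calG_binomial : all_in (balanced e m n) (calG K e m n).
Proof.
have minors_bin d L : all_in (is_step e m n d) L ->
    all_in (balanced e m n) (minors2 L).
  by apply: minors2_all_in => c c'; apply: det2_binomial.
have first_col_bin d L : all_in (is_step e m n d) L ->
    all_in (balanced e m n) (minors2_first_col L).
  by apply: minors2_first_col_all_in => c c'; apply: det2_binomial.
rewrite /calG; apply: all_in_cat setG'_binomial; rewrite /setG.
case: eqP => [m1|m1].
  apply: all_in_cat; first exact/minors_bin/matA1_step.
  apply: all_in_cat; first exact/first_col_bin/matB_step.
  exact: setL_binomial.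
have m2 : 2 <= m by lia.
by apply: all_in_cat; [exact/minors_bin/matA2_step | exact: setK_binomial].
Qed.

End AllBinomials.

(** * Leading monomials of degree two *)
Section Leads.

Variables (e m n : nat) (K : fieldType).
Implicit Types (s t u : seq nat) (g : {mpoly K[e - 2]}).

Local Notation avail := (avail e m n).
Local Notation x := (xvar K e m n).

(** The leading monomial of the homogenization of g is the product over t; the
    permutation allows t to be sorted, whatever the order of the factors in g. *)
Definition leads t g := exists t' u,
  [/\ perm_eq t' t, drops t' u
    & is_binomial m n g t' u \/ is_binomial m n g u t'].

Lemma leads_first t t' u : perm_eq t' t -> all avail t -> all avail u ->
  drops t' u -> value e t' = value e u ->
  leads t (xprod e m n K t' - xprod e m n K u)%R.
Proof.
move=> eq_t t_av u_av drop_tu eq_v; exists t', u; split=> //.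
by left; split=> //; rewrite (perm_all _ eq_t).
Qed.

Lemma leads_second t t' u : perm_eq t' t -> all avail t -> all avail u ->
  drops t' u -> value e t' = value e u ->
  leads t (xprod e m n K u - xprod e m n K t')%R.
Proof.
move=> eq_t t_av u_av drop_tu eq_v; exists t', u; split=> //.
by right; split=> //; rewrite (perm_all _ eq_t).
Qed.

Lemma perm_two (i j a b : nat) : a = i -> b = j -> perm_eq [:: a; b] [:: i; j].
Proof. by move=> -> ->. Qed.

Lemma perm_two_swap (i j a b : nat) :
  a = j -> b = i -> perm_eq [:: a; b] [:: i; j].
Proof. by move=> -> ->; apply/permPl; exact: (perm_catC [:: j] [:: i]). Qed.

Lemma perm_three (i j k a b c : nat) :
  a = i -> b = j -> c = k -> perm_eq [:: a; b; c] [:: i; j; k].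
Proof. by move=> -> -> ->. Qed.

Lemma perm_three_rot (i j k a b c : nat) :
  a = k -> b = i -> c = j -> perm_eq [:: a; b; c] [:: i; j; k].
Proof. by move=> -> -> ->; apply/permPl; exact: (perm_catC [:: k] [:: i; j]). Qed.

Lemma perm_three_rotr (i j k a b c : nat) :
  a = j -> b = k -> c = i -> perm_eq [:: a; b; c] [:: i; j; k].
Proof. by move=> -> -> ->; apply/permPl; exact: (perm_catC [:: j; k] [:: i]). Qed.

End Leads.

Arguments leads e m n {K} t g.

Ltac show_perm :=
  lazymatch goal with
  | |- is_true (perm_eq [:: _; _] [:: _; _]) =>
      first [ apply: perm_two; [lia_eq | lia_eq]
            | apply: perm_two_swap; [lia_eq | lia_eq] ]
  | |- is_true (perm_eq [:: _; _; _] [:: _; _; _]) =>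
      first [ apply: perm_three; [lia_eq | lia_eq | lia_eq]
            | apply: perm_three_rot; [lia_eq | lia_eq | lia_eq]
            | apply: perm_three_rotr; [lia_eq | lia_eq | lia_eq] ]
  end.

Ltac show_drops := rewrite /drops /=; first [done | lia_eq].

Ltac show_leads :=
  cbv beta; collect_vars; apply: leads_first;
  [show_perm | show_avails | show_avails | show_drops | rewrite /value /=; lia_eq].

Ltac in_map_at d tac :=
  lazymatch goal with
  | |- some_in _ (map _ (filter _ _)) =>
      apply: (some_in_map_filter (j := d)); [ | | | tac];
      [lia_any | lia_any | show_filter]
  | |- some_in _ (map _ _) =>
      apply: (some_in_map (j := d)); [ | | tac]; [lia_any | lia_any]
  end.

Ltac search_list map_tac tac :=
  lazymatch goal with
  | |- some_in _ (_ ++ _) =>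
      first [ apply: some_in_catl; search_list map_tac tac
            | apply: some_in_catr; search_list map_tac tac ]
  | |- some_in _ (_ :: _) =>
      first [ apply: some_in_head; tac
            | apply: some_in_behead; search_list map_tac tac ]
  | |- some_in _ (map _ _) => map_tac
  end.

(** In the quadratic families the leading monomial is x_k x_(k+j) or x_k x_(k-j),
    except for those whose leading monomials are x_(n-1) x_(n-3-j); this
    explains the two candidates for the parameter. *)
Ltac search_pair :=
  lazymatch goal with
  | |- some_in (leads _ _ _ [:: ?i; ?j]) _ =>
      search_list ltac:(first [ in_map_at (j - i) show_leads
                              | in_map_at (j - i - 2) show_leads ]) show_leads
  end.

(** Runs tac in every case of the nested conditionals in the goal, and leaves the
    final empty cases to [not_covered]. *)
Ltac walk_cases tac :=
  lazymatch goal with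
  | |- context [if _ then _ else _] =>
      let C := fresh "C" in
      case: ifP => C; [enter_case C; walk_cases tac | walk_cases tac]
  | |- context [some_in _ [::]] => idtac
  | |- _ => tac
  end.

(** The case distinctions that define L and K, as one disjunction: they exhaust
    all m and n, so the final empty lists in those definitions are never met. *)
Lemma mn_cases e m n : 10 <= e -> 1 <= m -> m < n -> n <= e - 2 ->
    (m, n) <> (e - 4, e - 3) ->
  (m = 1 /\ n = 2) \/ (m = 1 /\ n = 3) \/ (m = 1 /\ n = 4) \/
  (m = 1 /\ 5 <= n /\ n <= e - 4) \/ (m = 1 /\ n = e - 3) \/
  (m = 1 /\ n = e - 2) \/
  (m = 2 /\ n = 3) \/ (m = 2 /\ n = 4) \/ (m = 2 /\ n = 5) \/
  (m = 2 /\ 6 <= n /\ n <= e - 4) \/ (m = 2 /\ n = e - 3) \/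
  (m = 2 /\ n = e - 2) \/
  (m = 3 /\ n = 4) \/ (4 <= m /\ m <= e - 6 /\ n = m + 1) \/
  (m = e - 5 /\ n = e - 4) \/ (m = e - 3 /\ n = e - 2) \/
  (3 <= m /\ m <= e - 6 /\ n = m + 2) \/ (m = e - 5 /\ n = e - 3) \/
  (m = e - 4 /\ n = e - 2) \/
  (3 <= m /\ m + 2 < n /\ n <= e - 4) \/ (3 <= m /\ m + 2 < n /\ n = e - 3) \/
  (3 <= m /\ m + 2 < n /\ n = e - 2).
Proof.
move=> he hm hmn hn hne.
have hne' : ~ (m = e - 4 /\ n = e - 3).
  by move=> [em en]; apply: hne; rewrite em en.
clear hne.
have [m1|[m2|m3]] : m = 1 \/ m = 2 \/ 3 <= m by clear hne'; lia.
- have [?|[?|[?|[?|[?|?]]]]] : n = 2 \/ n = 3 \/ n = 4 \/ (5 <= n /\ n <= e - 4) \/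
    n = e - 3 \/ n = e - 2 by clear hne'; lia.
  + by do 0 right; left.
  + by do 1 right; left.
  + by do 2 right; left.
  + by do 3 right; left.
  + by do 4 right; left.
  + by do 5 right; left.
- have [?|[?|[?|[?|[?|?]]]]] : n = 3 \/ n = 4 \/ n = 5 \/ (6 <= n /\ n <= e - 4) \/
    n = e - 3 \/ n = e - 2 by clear hne'; lia.
  + by do 6 right; left.
  + by do 7 right; left.
  + by do 8 right; left.
  + by do 9 right; left.
  + by do 10 right; left.
  + by do 11 right; left.
have [?|[?|[?|?]]] : m <= e - 6 \/ m = e - 5 \/ m = e - 4 \/ m = e - 3.
- by clear hne'; lia.
- have [?|[?|[[? ?]|[?|?]]]] : n = m + 1 \/ n = m + 2 \/
    (m + 2 < n /\ n <= e - 4) \/ n = e - 3 \/ n = e - 2 by clear hne'; lia.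
  + have [?|?] : m = 3 \/ 4 <= m by clear hne'; lia.
      by do 12 right; left; split=> //; clear hne'; lia.
    by do 13 right; left.
  + by do 16 right; left.
  + by do 19 right; left.
  + by do 20 right; left; repeat split=> //; clear hne'; lia.
  + by do 21 right; repeat split=> //; clear hne'; lia.
- have [?|[?|?]] : n = e - 4 \/ n = e - 3 \/ n = e - 2 by clear hne'; lia.
  + by do 14 right; left.
  + by do 17 right; left.
  + by do 21 right; repeat split=> //; clear hne'; lia.
- by do 18 right; left; split=> //; lia.
- by do 15 right; left; split=> //; clear hne'; lia.
Qed.

Ltac not_covered H :=
  exfalso; decompose [or] H; clear H;
  match goal with N : _ = false |- _ =>
     move: N; repeat match goal with N' : _ = false |- _ => clear N' end; lia
  end.

Lemma mem_catl (T : eqType) (g : T) L1 L2 : g \in L1 -> g \in L1 ++ L2.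
Proof. by rewrite mem_cat => ->. Qed.

Lemma mem_catr (T : eqType) (g : T) L1 L2 : g \in L2 -> g \in L1 ++ L2.
Proof. by rewrite mem_cat orbC => ->. Qed.

Section UnitStepMinors.

Variables (e m n : nat) (K : fieldType).
Hypotheses (he : 10 <= e) (hm : 1 <= m) (hmn : m < n) (hn : n <= e - 2).

Local Notation avail := (avail e m n).
Local Notation x := (xvar K e m n).
Local Notation matA := (if m == 1 then matA1 K e m n else matA2 K e m n).

Lemma minors_sub_calG g : g \in minors2 matA -> g \in calG K e m n.
Proof.
move=> gA; rewrite /calG mem_cat; apply/orP; left; move: gA; rewrite /setG.
by case: (m == 1) => gA; rewrite mem_cat gA.
Qed.

Lemma mem_step_cols d a b i :
  a <= i -> i <= b -> (x i, x (i + d)) \in step_cols K e m n d a b.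
Proof.
move=> le_ai le_ib; apply/mapP; exists i => //.
by rewrite mem_index_iota le_ai ltnS.
Qed.

Lemma in_order_step_cols d a b i j : a <= i -> i < j -> j <= b ->
  in_order (x i, x (i + d)) (x j, x (j + d)) (step_cols K e m n d a b).
Proof.
move=> le_ai lt_ij le_jb.
have -> : step_cols K e m n d a b =
    step_cols K e m n d a i ++ step_cols K e m n d i.+1 b.
  rewrite /step_cols -map_cat /closed_range /index_iota; congr map.
  have -> : b.+1 - a = (i.+1 - a) + (b.+1 - i.+1) by lia.
  by rewrite iotaD; congr (_ ++ iota _ _); lia.
by apply: in_order_cross; apply: mem_step_cols; lia.
Qed.

Lemma matA1_rcons : matA1 K e m n =
  (step_cols K e m n 1 2 (n - 2) ++ step_cols K e m n 1 (n + 1) (e - 2))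
  ++ [:: (x (e - 1), x 0 ^+ 2)%R].
Proof. exact: catA. Qed.

Lemma matA2_rcons : matA2 K e m n =
  (step_cols K e m n 1 0 (m - 2) ++ (step_cols K e m n 1 (m + 1) (n - 2) ++
    step_cols K e m n 1 (n + 1) (e - 2))) ++ [:: (x (e - 1), x 0 ^+ 2)%R].
Proof. by rewrite /matA2 -!catA. Qed.

Lemma in_order_matA i j : avail i -> avail i.+1 -> avail j -> avail j.+1 ->
  i < j -> in_order (x i, x (i + 1)) (x j, x (j + 1)) matA.
Proof.
move=> /and3P [_ /eqP ? /eqP ?] /and3P [_ /eqP ? /eqP ?].
move=> /and3P [_ /eqP ? /eqP ?] /and3P [? /eqP ? /eqP ?] lt_ij.
have [m1|m1] := eqVneq m 1.
  rewrite matA1_rcons; apply: in_order_catl; have [?|?] : j < n \/ n < j by lia.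
    by apply: in_order_catl; apply: in_order_step_cols; lia.
  have [?|?] : i < n \/ n < i by lia.
    by apply: in_order_cross; apply: mem_step_cols; lia.
  by apply: in_order_catr; apply: in_order_step_cols; lia.
rewrite matA2_rcons; apply: in_order_catl; have [?|?] : j < m \/ m < j by lia.
  by apply: in_order_catl; apply: in_order_step_cols; lia.
have [?|?] : i < m \/ m < i by lia.
  apply: in_order_cross; first by apply: mem_step_cols; lia.
  have [?|?] : j < n \/ n < j by lia.
    by apply: mem_catl; apply: mem_step_cols; lia.
  by apply: mem_catr; apply: mem_step_cols; lia.
apply: in_order_catr; have [?|?] : j < n \/ n < j by lia.
  by apply: in_order_catl; apply: in_order_step_cols; lia.
have [?|?] : i < n \/ n < i by lia.
  by apply: in_order_cross; apply: mem_step_cols; lia.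
by apply: in_order_catr; apply: in_order_step_cols; lia.
Qed.

Lemma in_order_matA_last i : avail i -> avail i.+1 ->
  in_order (x i, x (i + 1)) (x (e - 1), x 0 ^+ 2)%R matA.
Proof.
move=> /and3P [_ /eqP ? /eqP ?] /and3P [? /eqP ? /eqP ?].
have [m1|m1] := eqVneq m 1.
  rewrite matA1_rcons; apply: in_order_cross; last exact: mem_head.
  have [?|?] : i < n \/ n < i by lia.
    by apply: mem_catl; apply: mem_step_cols; lia.
  by apply: mem_catr; apply: mem_step_cols; lia.
rewrite matA2_rcons; apply: in_order_cross; last exact: mem_head.
have [?|?] : i < m \/ m < i by lia.
  by apply: mem_catl; apply: mem_step_cols; lia.
apply: mem_catr; have [?|?] : i < n \/ n < i by lia.
  by apply: mem_catl; apply: mem_step_cols; lia.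
by apply: mem_catr; apply: mem_step_cols; lia.
Qed.

(** The minor of the columns that start at i - 1 and at j. *)
Lemma pair1_leads i j : avail i -> avail j -> i <= j -> 0 < i ->
  avail (i - 1) -> avail (j + 1) ->
  some_in (leads e m n [:: i; j]) (calG K e m n).
Proof.
move=> i_av j_av le_ij i_gt0 i1_av j1_av.
exists (det2 (x (i - 1), x (i - 1 + 1)) (x j, x (j + 1))).
  apply/minors_sub_calG/det2_in_minors2/in_order_matA => //; last by lia.
    by rewrite subn1 prednK.
  by rewrite -addn1.
rewrite /det2 subnK //=; collect_vars; apply: leads_second.
- exact: perm_two_swap.
- by rewrite /= i_av j_av.
- by rewrite /= i1_av j1_av.
- by show_drops.
- by rewrite /value /=; lia.
Qed.

(** The minor of the column that starts at k and the last one. *)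
Lemma square_leads k : avail k -> avail (k + 1) -> avail 0 ->
  some_in (leads e m n [:: 0; 0; k]) (calG K e m n).
Proof.
move=> k_av k1_av av0; have e1_av : avail (e - 1) by show_avail.
exists (det2 (x k, x (k + 1)) (x (e - 1), x 0 ^+ 2)%R).
  apply/minors_sub_calG/det2_in_minors2; apply: in_order_matA_last.
    exact: k_av.
  by rewrite -addn1; exact: k1_av.
rewrite /det2 /=; collect_vars; apply: leads_first.
- exact: perm_three_rot.
- by rewrite /= k_av av0.
- by rewrite /= e1_av k1_av.
- by [].
- by rewrite /value /=; lia.
Qed.

End UnitStepMinors.

Section WidePairs.

Variables (e m n : nat) (K : fieldType).
Hypotheses (he : 10 <= e) (hm : 1 <= m) (hmn : m < n) (hn : n <= e - 2).
Hypothesis (hne : (m, n) <> (e - 4, e - 3)).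

Local Notation avail := (avail e m n).
Local Notation x := (xvar K e m n).

Lemma some_in_sub (P : {mpoly K[e - 2]} -> Prop) L :
  {subset L <= calG K e m n} -> some_in P L -> some_in P (calG K e m n).
Proof. by move=> sL [g /sL gG Pg]; exists g. Qed.

Lemma first_col_sub_calG : m = 1 ->
  {subset minors2_first_col (matB K e m n) <= calG K e m n}.
Proof.
move=> m1 g gB; rewrite /calG; apply: mem_catl.
by rewrite /setG (introT eqP m1); apply: mem_catr; apply: mem_catl.
Qed.

Lemma setLK_sub_calG :
  {subset (if m == 1 then setL K e m n else setK K e m n) <= calG K e m n}.
Proof.
move=> g; rewrite /calG => gL; apply: mem_catl; move: gL; rewrite /setG.
by case: (m == 1) => gL; do 2?apply: mem_catr.
Qed.

Lemma setG'_sub_calG : {subset setG' K e m n <= calG K e m n}.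
Proof. by move=> g gG'; apply: mem_catr. Qed.

(** The quadratic elements of L do not have x_2 x_j as leading monomials; the minors
    with the first column of B do. *)
Lemma matB_pair j : m = 1 -> 3 <= n -> avail j -> avail (j + 2) -> 2 <= j ->
  some_in (leads e m n [:: 2; j]) (calG K e m n).
Proof.
move=> m1 n3 j_av j2_av j2; apply: (some_in_sub (first_col_sub_calG m1)).
have av0 : avail 0 by show_avail.
have av2 : avail 2 by show_avail.
exists (det2 (x 0, x 2) (x j, x (j + 2))).
  rewrite /matB (_ : (n == 2) = false); last by lia.
  apply: map_f; have /and3P [_ _ /eqP jn] := j_av.
  have /and3P [? _ /eqP j2n] := j2_av.
  have [?|[jE|?]] : j <= n - 3 \/ j = n - 1 \/ n + 1 <= j by lia.
  - by apply: mem_catl; apply: mem_step_cols; lia.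
  - apply: mem_catr; rewrite jE (_ : n - 1 + 2 = n + 1); last by lia.
    exact: mem_head.
  - apply: mem_catr; rewrite inE; apply/orP; right; apply: mem_catl.
    by apply: mem_step_cols; lia.
rewrite /det2 /=; collect_vars; apply: leads_second.
- exact: perm_two_swap.
- by rewrite /= av2 j_av.
- by rewrite /= av0 j2_av.
- by show_drops.
- by rewrite /value /=; lia.
Qed.

(** The index 2 is missing too if n = 2, so that the steps of B have length 3. *)
Lemma matB2_pair j : m = 1 -> n = 2 -> avail j -> avail (j + 3) -> 3 <= j ->
  some_in (leads e m n [:: 3; j]) (calG K e m n).
Proof.
move=> m1 n2 j_av j3_av j3; apply: (some_in_sub (first_col_sub_calG m1)).
have av0 : avail 0 by show_avail.
have av3 : avail 3 by show_avail.
exists (det2 (x 0, x 3) (x j, x (j + 3))).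
  rewrite /matB (introT eqP n2).
  have /and3P [? _ _] := j3_av.
  by apply: map_f; apply: mem_catl; apply: mem_step_cols; lia.
rewrite /det2 /=; collect_vars; apply: leads_second.
- exact: perm_two_swap.
- by rewrite /= av3 j_av.
- by rewrite /= av0 j3_av.
- by show_drops.
- by rewrite /value /=; lia.
Qed.

Lemma matB_cube : m = 1 -> n != e - 2 ->
  some_in (leads e m n [:: 0; 0; 0]) (calG K e m n).
Proof.
move=> m1 ne2; apply: (some_in_sub (first_col_sub_calG m1)).
rewrite /matB; case: eqP => n2.
  exists (det2 (x 0, x 3) (x (e - 3), x 0 ^+ 2)%R).
    by apply: map_f; apply: mem_catr; apply: mem_head.
  rewrite /det2 /=; show_leads.
exists (det2 (x 0, x 2) (x (e - 2), x 0 ^+ 2)%R).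
  apply: map_f; apply: mem_catr; rewrite inE; apply/orP; right.
  by apply: mem_catr; rewrite ne2; apply: mem_head.
rewrite /det2 /=; show_leads.
Qed.

(** For m = 1 and i = 2 this is a minor of B. Otherwise one of i - 1 and j + 1 is m
    or n, and the families of L and K correspond to these possibilities. *)
Lemma pair2_leads i j : avail i -> avail j -> i <= j -> 2 <= i ->
  avail (i - 2) -> avail (j + 2) -> ~~ (avail (i - 1) && avail (j + 1)) ->
  some_in (leads e m n [:: i; j]) (calG K e m n).
Proof.
move=> i_av j_av le_ij i_ge2 i2_av j2_av blocked.
have [[m1 i2]|not_B] : (m = 1 /\ i = 2) \/ ~ (m = 1 /\ i = 2) by lia.
  by rewrite i2 in i_av le_ij *; apply: matB_pair => //; have /and3P [] := i_av; lia.
apply: (some_in_sub setLK_sub_calG).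
have {}blocked : i = m + 1 \/ i = n + 1 \/ j + 1 = m \/ j + 1 = n.
  clear - blocked i_ge2 i_av j2_av; move: i_av j2_av blocked; rewrite /avail; lia.
have {}blocked : (i = m + 1 /\ i = j) \/ (i = m + 1 /\ i < j) \/ i = n + 1 \/
    j + 1 = m \/ (i <> m + 1 /\ j + 1 = n /\ j <= i + 1) \/
    (i <> m + 1 /\ j + 1 = n /\ i + 2 <= j).
  by clear - blocked le_ij; lia.
move: i_av j_av i2_av j2_av => /and3P [_ /eqP im /eqP iN] /and3P [_ /eqP jm /eqP jn].
move=> /and3P [_ /eqP i2m /eqP i2n] /and3P [lt_j2 /eqP j2m /eqP j2n].
have covered := mn_cases he hm hmn hn hne; clear hne.
move: not_B le_ij i_ge2 lt_j2 im iN jm jn i2m i2n j2m j2n blocked.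
rewrite /setL /setK.
walk_cases ltac:(idtac; clear covered hm hmn hn;
  try subst m; try subst n; do 12 intro;
  move=> [|[|[|[|[|]]]]] blocked; split_hyps;
  first [by exfalso; lia | search_pair]).
all: first [ not_covered covered
  | by clear covered; do 12 intro; move=> [|[|[|[|[|]]]]] blocked; exfalso; lia].
Qed.

(** Each of m and n blocks one of d = 1 and d = 2, so i and j are close to them. *)
Lemma pair3_leads i j : avail i -> avail j -> i <= j -> 3 <= i ->
  avail (i - 3) -> avail (j + 3) -> ~~ (avail (i - 1) && avail (j + 1)) ->
  ~~ (avail (i - 2) && avail (j + 2)) ->
  some_in (leads e m n [:: i; j]) (calG K e m n).
Proof.
move=> i_av j_av le_ij i_ge3 i3_av j3_av blocked1 blocked2.
have [[m1 [n2 i3]]|not_B] :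
    (m = 1 /\ n = 2 /\ i = 3) \/ ~ (m = 1 /\ n = 2 /\ i = 3) by lia.
  by rewrite i3 in i_av le_ij *; apply: matB2_pair => //;
    have /and3P [] := i_av; lia.
apply: (some_in_sub setLK_sub_calG).
have {}blocked : (i = n + 1 /\ i = m + 2) \/ (j + 1 = m /\ j + 2 = n) \/
    (i = m + 1 /\ j + 2 = n) \/ (i = m + 2 /\ j + 1 = n).
  have {}blocked1 : i = m + 1 \/ i = n + 1 \/ j + 1 = m \/ j + 1 = n.
    clear - blocked1 i_ge3 i_av j3_av.
    by move: i_av j3_av blocked1; rewrite /avail; lia.
  have {}blocked2 : i = m + 2 \/ i = n + 2 \/ j + 2 = m \/ j + 2 = n.
    clear - blocked2 i_ge3 i_av j3_av.
    by move: i_av j3_av blocked2; rewrite /avail; lia.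
  by clear - blocked1 blocked2 hmn le_ij; lia.
clear blocked1 blocked2.
move: i_av j_av i3_av j3_av => /and3P [_ /eqP im /eqP iN] /and3P [_ /eqP jm /eqP jn].
move=> /and3P [_ /eqP i3m /eqP i3n] /and3P [lt_j3 /eqP j3m /eqP j3n].
have covered := mn_cases he hm hmn hn hne; clear hne.
move: not_B le_ij i_ge3 lt_j3 im iN jm jn i3m i3n j3m j3n blocked.
rewrite /setL /setK.
walk_cases ltac:(idtac; clear covered hm hmn hn;
  try subst m; try subst n; do 12 intro;
  move=> [|[|[|]]] blocked; split_hyps;
  first [by exfalso; lia_eq | search_pair | by exfalso; lia]).
all: first [ not_covered covered
  | by clear covered; do 12 intro; move=> [|[|[|]]] blocked; split_hyps; subst;
    exfalso; lia].
Qed.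

End WidePairs.

(** * Leading monomials of degree three *)
Lemma exceptionalI e m n i j k : i = 0 ->
  (n = e - 2 /\ j = 0 /\ k = e - 3) \/
  (n = e - 2 /\ m = 1 /\ j = 3 /\ k = e - 3) \/
  (n = e - 2 /\ m = e - 4 /\ j = 0 /\ k = e - 5) \/
  (n = e - 2 /\ m = e - 3 /\ j <= 1 /\ k = e - 4) \/
  (m = 1 /\ j = 2 /\ k = e - 2) \/
  (m = 1 /\ n = 2 /\ j = 3 /\ (k = e - 3 \/ k = e - 2)) \/
  (m = 1 /\ n = 3 /\ j = 4 /\ k = e - 2) \/
  (m = 2 /\ n = 3 /\ j = 4 /\ k = e - 2) ->
  exceptional e m n i j k.
Proof.
move=> -> H; rewrite /exceptional /=.
move: H => [[-> [-> ->]]|H]; first by rewrite !eqxx.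
move: H => [[-> [-> [-> ->]]]|H]; first by rewrite !eqxx !orbT.
move: H => [[-> [-> [-> ->]]]|H]; first by rewrite !eqxx !orbT.
move: H => [[-> [-> [-> ->]]]|H]; first by rewrite !eqxx !orbT.
move: H => [[-> [-> ->]]|H]; first by rewrite !eqxx !orbT.
move: H => [[-> [-> [-> [->|->]]]]|H]; try by rewrite !eqxx !orbT.
move: H => [[-> [-> [-> ->]]]|[-> [-> [-> ->]]]]; by rewrite !eqxx !orbT.
Qed.

(** Within a case of L or K, arithmetic decides most of the conditions in G'. *)
Ltac resolve_ifs :=
  repeat match goal with
  | |- context [if ?b then _ else _] =>
      first [ have -> : b = false by lia_eq
            | have -> : b = true by lia_eq
            | case: (boolP b) => ? ]
  end.

Ltac search_triple :=
  first
    [ left; search_list fail show_leads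
    | right; left; rewrite /setG' ?inE; resolve_ifs; search_list fail show_leads
    | right; right; apply: exceptionalI; [lia_eq | some_disjunct lia_eq] ].

Section Triples.

Variables (e m n : nat) (K : fieldType).
Hypotheses (he : 10 <= e) (hm : 1 <= m) (hmn : m < n) (hn : n <= e - 2).
Hypothesis (hne : (m, n) <> (e - 4, e - 3)).

Local Notation avail := (avail e m n).

(** A triple (0, 0, k) comes from the last column of A if k + 1 is an index of a
    variable, and from the last column of B if k = 0, m = 1 and n < e - 2. The
    others come from L, K or G', or are exceptional. *)
Lemma triple_leads i j k : avail i -> avail j -> avail k ->
  i <= j -> j <= k -> k < e - 1 -> triple_shape e m n i j k ->
  some_in (leads e m n [:: i; j; k]) (calG K e m n) \/ exceptional e m n i j k.
Proof.
move=> i_av j_av k_av le_ij le_jk lt_k shape.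
have [/and3P [_ im iN] [/and3P [_ jm jn] /and3P [_ km kn]]] := (i_av, (j_av, k_av)).
have {}shape : (i = 0 /\ j = 0 /\ avail (k + 1)) \/
    (i = 0 /\ j = 0 /\ k = 0 /\ m = 1 /\ n <> e - 2) \/
    (i = 0 /\ j = 0 /\ k = 0 /\ m = 1 /\ n = e - 2) \/
    (i = 0 /\ j = 0 /\ 0 < k /\ k + 1 = m) \/ (i = 0 /\ j = 0 /\ k + 1 = n) \/
    (~ (i = 0 /\ j = 0) /\ triple_shape e m n i j k).
  have [i0|?] := eqVneq i 0; last first.
    by do 5 right; split=> //; case=> ? ?; lia.
  have [j0|?] := eqVneq j 0; last first.
    by do 5 right; split=> //; case=> ? ?; lia.
  have [?|[?|[?|[?|?]]]] : avail (k + 1) \/ (k = 0 /\ m = 1 /\ n <> e - 2) \/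
    (k = 0 /\ m = 1 /\ n = e - 2) \/ (0 < k /\ k + 1 = m) \/ k + 1 = n.
  - by rewrite /avail; clear - hm lt_k; lia.
  - by left.
  - by do 1 right; left.
  - by do 2 right; left.
  - by do 3 right; left.
  - by do 4 right; left.
case: shape => [[-> [-> k1_av]]|shape].
  by left; apply: square_leads => //; apply/and3P; split; lia.
case: shape => [[-> [-> [-> [m1 /eqP ne2]]]]|shape].
  by left; apply: matB_cube.
suff [LK|[G'|exc]] : some_in (leads e m n [:: i; j; k])
      (if m == 1 then setL K e m n else setK K e m n) \/
    some_in (leads e m n [:: i; j; k]) (setG' K e m n) \/ exceptional e m n i j k.
- by left; apply: some_in_sub LK; apply: setLK_sub_calG.
- by left; apply: some_in_sub G'; apply: setG'_sub_calG.
- by right.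
have covered := mn_cases he hm hmn hn hne; clear hne.
clear i_av j_av k_av.
move: le_ij le_jk lt_k (elimN eqP im) (elimN eqP iN) (elimN eqP jm)
  (elimN eqP jn) (elimN eqP km) (elimN eqP kn) shape.
clear im iN jm jn km kn; rewrite /setL /setK /triple_shape.
walk_cases ltac:(idtac; clear covered hm hmn hn;
  try subst m; try subst n; do 9 intro; move=> shape; split_hyps;
  first [by exfalso; lia | search_triple]).
all: first [ not_covered covered
  | clear covered hm hmn hn; try subst m; try subst n; do 9 intro; move=> shape;
    split_hyps; first [by exfalso; lia | search_triple]].
Qed.

End Triples.

(** * Distinct monomials of the same bidegree are not both standard *)
Section Assembly.

Variables (e m n : nat) (K : fieldType).
Hypotheses (he : 10 <= e) (hm : 1 <= m) (hmn : m < n) (hn : n <= e - 2).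
Hypothesis (hne : (m, n) <> (e - 4, e - 3)).
Implicit Types (s t : seq nat).

Local Notation avail := (avail e m n).
Local Notation widenable := (widenable e m n).
Local Notation hmon := (hmon e m n).

Lemma widenable_leads i j : avail i -> avail j -> i <= j -> widenable i j ->
  some_in (leads e m n [:: i; j]) (calG K e m n).
Proof.
move=> i_av j_av le_ij wij.
have [d [/andP [d_gt0 d_le3] le_di id_av jd_av d_min]] :=
  widenable_small he hm hmn hn i_av j_av le_ij wij.
have [d1|[d2|d3]] : d = 1 \/ d = 2 \/ d = 3 by clear - d_gt0 d_le3; lia.
- by rewrite d1 in le_di id_av jd_av; apply: pair1_leads.
- by rewrite d2 in le_di id_av jd_av d_min; apply: pair2_leads => //; apply: d_min.
by rewrite d3 in le_di id_av jd_av d_min; apply: pair3_leads => //; apply: d_min.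
Qed.

(** For a list without the index e - 1: the monomial is divisible by a leading
    monomial of the basis, whatever powers of x_(e-1) and y multiply it. *)
Definition reducible s :=
  exists2 t, subseq t s & some_in (leads e m n t) (calG K e m n).

Lemma reducible_subseq s s' : subseq s s' -> reducible s -> reducible s'.
Proof. by move=> ss' [t ts lead_t]; exists t => //; apply: subseq_trans ss'. Qed.

Lemma triple_reducible i j k : avail i -> avail j -> avail k ->
  i <= j -> j <= k -> k < e - 1 ->
  reducible [:: i; j; k] \/ exceptional e m n i j k.
Proof.
move=> i_av j_av k_av le_ij le_jk lt_k; have le_ik := leq_trans le_ij le_jk.
have [wij|wij] := boolP (widenable i j).
  left; exists [:: i; j]; last exact: widenable_leads.
  by rewrite /= !eqxx.
have [wik|wik] := boolP (widenable i k).
  left; exists [:: i; k]; last exact: widenable_leads.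
  exact: (cat_subseq (subseq_refl [:: i]) (subseq_cons [:: k] j)).
have [wjk|wjk] := boolP (widenable j k).
  left; exists [:: j; k]; last exact: widenable_leads.
  exact: subseq_cons.
have shape :=
  triple_shapeP he hm hmn hn hne i_av j_av k_av le_ij le_jk lt_k wij wik wjk.
case: (triple_leads K he hm hmn hn hne i_av j_av k_av le_ij le_jk lt_k shape).
  by left; exists [:: i; j; k].
by right.
Qed.

(** Only lists of size at least four need a further idea: three of the triples
    in the first four entries cannot be exceptional at once. *)
Lemma reducible_or_standard s : all avail s -> sorted leq s ->
  all (ltn^~ (e - 1)) s -> reducible s \/ standard e m n s.
Proof.
case: s => [|i [|j [|k s]]]; try by right.
  move=> /and3P [i_av j_av _] /andP [le_ij _] _ /=.
  have [wij|_] := boolP (widenable i j); last by right.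
  by left; exists [:: i; j] => //; apply: widenable_leads.
move=> /and4P [i_av j_av k_av s_av] /and3P [le_ij le_jk s_sort].
move=> /and4P [_ _ lt_k s_lt].
have := triple_reducible i_av j_av k_av le_ij le_jk lt_k.
case: s s_av s_sort s_lt => [|l s]; first by move=> _ _ _ [|]; [left|right].
move=> /andP [l_av _] /andP [le_kl _] /andP [lt_l _].
have le_jl := leq_trans le_jk le_kl; have le_ik := leq_trans le_ij le_jk.
have sub4 t : subseq t [:: i; j; k; l] -> subseq t [:: i, j, k, l & s].
  by move=> t_sub; rewrite -[t]cats0; exact: (cat_subseq t_sub (sub0seq s)).
case=> [red|exc].
  left; apply: reducible_subseq red; apply: sub4; by rewrite /= !eqxx.
have {}exc := exceptionalE exc.
case: (triple_reducible j_av k_av l_av le_jk le_kl lt_l)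
  => [red|/exceptionalE exc'].
  by left; apply: reducible_subseq red; apply: sub4; apply: subseq_cons.
case: (triple_reducible i_av k_av l_av le_ik le_kl lt_l)
  => [red|/exceptionalE exc''].
  left; apply: reducible_subseq red; apply: sub4.
  exact: (cat_subseq (subseq_refl [:: i]) (subseq_cons [:: k; l] j)).
by exfalso; clear - he exc exc' exc''; split_hyps; lia.
Qed.

Lemma leads_homogenize t (g : {mpoly K[e - 2]}) : leads e m n t g ->
  exists2 t', perm_eq t' t &
    is_lead_monomial (@grevlex_lt _) (homogenize g) (hmon t' 0).
Proof.
move=> [t' [u [eq_t drop_tu g_bin]]]; exists t' => //.
apply: is_lead_binomial drop_tu => //; lia.
Qed.

Lemma reducible_divides s c : reducible [seq i <- s | i != e - 1] ->
  exists g a, [/\ g \in calG_hom K e m n,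
    is_lead_monomial (@grevlex_lt _) g a & (a <= hmon s c)%MM].
Proof.
case=> t t_sub [g gG lead_g]; have [t' eq_t lead_t'] := leads_homogenize lead_g.
exists (homogenize g), (hmon t' 0); split=> //; first exact: map_f.
apply: hmon_le => i; rewrite (permP eq_t); apply: leq_count_subseq.
exact: subseq_trans t_sub (filter_subseq _ _).
Qed.

Lemma split_top s :
  perm_eq s ([seq i <- s | i != e - 1] ++ nseq (count_mem (e - 1) s) (e - 1)).
Proof.
rewrite perm_sym -[X in _ ++ X](_ : [seq i <- s | i == e - 1] = _); last first.
  rewrite -size_filter; apply/all_pred1P; exact: filter_all.
by rewrite perm_catC (perm_filterC (pred1 (e - 1))).
Qed.

Lemma value_perm s t : perm_eq s t -> value e s = value e t.
Proof. by move=> eq_st; rewrite !value_sum; apply: perm_big. Qed.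

Lemma value_top q : value e (nseq q (e - 1)) = q * (2 * e - 1).
Proof. by rewrite /value map_nseq sumn_nseq mulnC; congr (_ * _); lia. Qed.

Lemma hmon_perm s t c : perm_eq s t -> hmon s c = hmon t c.
Proof.
move=> /permP eq_st; congr (mnmwiden _ + _)%MM.
by apply/mnmP => k; rewrite !monE.
Qed.

(** If neither monomial is divisible, then their lists without e - 1 are standard
    with congruent values, hence equal; the equality of the values then gives
    the exponent of x_(e-1), and the degree gives that of y. *)
Lemma standard_separates a b : bidegree m n a = bidegree m n b -> a != b ->
  exists g c, [/\ g \in calG_hom K e m n,
    is_lead_monomial (@grevlex_lt _) g c & (c <= a)%MM || (c <= b)%MM].
Proof.
have e_gt1 : 1 < e by lia.
have [s [c [s_av s_sort ->]]] := hmon_surj hmn hn e_gt1 a.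
have [t [d [t_av t_sort ->]]] := hmon_surj hmn hn e_gt1 b.
move=> eq_deg neq_ab.
pose s0 := [seq i <- s | i != e - 1]; pose t0 := [seq i <- t | i != e - 1].
have below u : all avail u -> all (ltn^~ (e - 1)) [seq i <- u | i != e - 1].
  move=> u_av; apply/allP => i; rewrite mem_filter => /andP [ne_i /(allP u_av)].
  by case/and3P => lt_i _ _ /=; clear - lt_i ne_i; lia.
have sub_av u : all avail u -> all avail [seq i <- u | i != e - 1].
  move=> u_av; apply/allP => i; rewrite mem_filter => /andP [_]; exact: (allP u_av).
have sub_sort u : sorted leq u -> sorted leq [seq i <- u | i != e - 1].
  by apply: sorted_filter; apply: leq_trans.
case: (reducible_or_standard (sub_av _ s_av) (sub_sort _ s_sort) (below _ s_av)).
  case/(reducible_divides c) => g [c' [Gg lead_g le_c']].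
  by exists g, c'; rewrite le_c'.
move=> s_std.
case: (reducible_or_standard (sub_av _ t_av) (sub_sort _ t_sort) (below _ t_av)).
  case/(reducible_divides d) => g [c' [Gg lead_g le_c']].
  by exists g, c'; rewrite le_c' orbT.
move=> t_std; case/negP: neq_ab.
have eq_mdeg : mdeg (hmon s c) = mdeg (hmon t d).
  have := bidegree_mdeg hmn hn e_gt1 (hmon t d).
  rewrite -eq_deg (bidegree_mdeg hmn hn e_gt1) => /eqP.
  by rewrite eqn_pmul2r ?subn_gt0 => [/eqP|]; last by lia.
move: eq_deg; rewrite !bidegree_hmon // => -[]; rewrite -!value_sum => eq_v _.
have eq_split := eq_v.
rewrite (value_perm (split_top s)) (value_perm (split_top t)) in eq_split.
rewrite !value_cat !value_top in eq_split.
have eq_st : s0 = t0.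
  apply: (standard_value_inj he hm hmn hn) => //;
    [exact: sub_av | exact: sub_av | exact: sub_sort | exact: sub_sort
    | exact: below | exact: below | ].
  by rewrite -(modnMDl (count_mem (e - 1) s)) addnC eq_split addnC modnMDl.
have eq_q : count_mem (e - 1) s = count_mem (e - 1) t.
  move/eqP: eq_split; rewrite -/s0 -/t0 eq_st eqn_add2l eqn_pmul2r => [/eqP //|].
  by clear - he; lia.
have perm_st : perm_eq s t.
  apply: perm_trans (split_top s) _; rewrite -/s0 eq_st eq_q perm_sym.
  exact: split_top.
have eq_cd : c = d.
  by move: eq_mdeg; rewrite !mdeg_hmon // (perm_size perm_st) => /addnI.
by rewrite eq_cd (hmon_perm _ perm_st).
Qed.

End Assembly.

Theorem corollary4p7 (K : closedFieldType) (charK : [pchar K]%R =i pred0)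
    (e m n : nat) (he : 10 <= e) (hm : 1 <= m) (hmn : m < n) (hn : n <= e - 2)
    (hne : (m, n) <> (e - 4, e - 3)) :
  is_groebner_basis (@grevlex_lt (e - 2).+1)
    (calG_hom K e m n) (@toric_ideal K e m n).
Proof.
have e_gt1 : 1 < e by lia.
apply: (@groebner_of_fibers _ _ _ _ (@bidegree e m n)).
- exact: grevlex_irr.
- exact: grevlex_trans.
- exact: grevlexD.
- by move=> a b d eq_ab; rewrite !bidegreeD eq_ab.
- move=> a b eq_ab; have := bidegree_mdeg hmn hn e_gt1 b.
  rewrite -eq_ab (bidegree_mdeg hmn hn e_gt1) => /eqP.
  by rewrite eqn_pmul2r => [/eqP|]; last by lia.
- move=> g /mapP [f fG ->].
  have [t [u f_bin]] := calG_binomial he hm hmn hn fG.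
  exact: (is_binomial_toric hmn hn e_gt1 f_bin).
- by move=> p a; apply: toric_cancel.
by move=> a b; apply: standard_separates.
Qed.
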